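(* Let $\mathfrak{g}$ be a semisimple Lie algebra, let $*$ be a Hopf $*$-structure on $\mathcal{U}(\mathfrak{g})$ and $*'$ a Hopf $*$-structure on the Drinfeld-Jimbo algebra $\mathcal{U}_\hbar(\mathfrak{g})$ such that $(\mathcal{U}_\hbar(\mathfrak{g}),*')$ is a deformation of $(\mathcal{U}(\mathfrak{g}),* )$ as Hopf $*$-algebra, and let $\Delta_\hbar,\varepsilon_\hbar,S_\hbar$ be the Hopf structure on $\mathcal{U}(\mathfrak{g})[[\hbar]]$ transferred from $\mathcal{U}_\hbar(\mathfrak{g})$ by an isomorphism of $*$-algebras $\alpha:(\mathcal{U}_\hbar(\mathfrak{g}),*')\to(\mathcal{U}(\mathfrak{g})[[\hbar]],* )$. Let $\mathcal{F}$ be a Drinfeld twist from $\Delta$ to $\Delta_\hbar$ which is real, i.e. $( *\otimes * )(\mathcal{F})=(S\otimes S)(\mathcal{F}_{21})$, and let $(\mathcal{X},\mu,* )$ be an $\hbar$-adic module $*$-algebra of $(\mathcal{U}(\mathfrak{g})[[\hbar]],\Delta,\varepsilon,S,* )$, with action denoted $\triangleright$. Define $$\mu_\hbar(x\otimes y):=\mu(\mathcal{F}^{-1}\triangleright[x\otimes y]),\qquad x^{*_\hbar}:=\sigma^{-1}\triangleright x^*$$ for all $x,y\in\mathcal{X}$, where $\sigma\in\mathcal{U}(\mathfrak{g})[[\hbar]]$ is the unique element with $\sigma=1+O(\hbar)$, $S_\hbar(g)=\sigma S(g)\sigma^{-1}$ for all $g$, and $\Delta_\hbar(\sigma)=\sigma\otimes\sigma$.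 Then $(\mathcal{X},\mu_\hbar,*_\hbar)$ is a module $*$-algebra of $(\mathcal{U}(\mathfrak{g})[[\hbar]],\Delta_\hbar,\varepsilon_\hbar,S_\hbar,* )$.
   Context: $\mathcal{U}(\mathfrak{g})$ is the (complex) enveloping algebra with its canonical Hopf structure $\Delta(g)=g\otimes 1+1\otimes g$, $\varepsilon(g)=0$, $S(g)=-g$ for $g\in\mathfrak{g}$; $\mathcal{U}(\mathfrak{g})[[\hbar]]$ carries its order-by-order extension. $\mathcal{U}_\hbar(\mathfrak{g})$ is the $\hbar$-adic Drinfeld-Jimbo deformation of $\mathcal{U}(\mathfrak{g})$, with Hopf structure $\Delta',\varepsilon',S'$. A Hopf $*$-structure is a conjugate-linear involutive algebra antihomomorphism $*$ with $\Delta(g^* )=(\Delta g)^{*\otimes *}$ (in the $\hbar$-adic case $\hbar^*=\hbar$). An $\hbar$-adic Hopf $*$-algebra $H'$ is a deformation of $H$ if $H'/\hbar H'\cong H$ as Hopf $*$-algebras. The isomorphism of $*$-algebras $\alpha$ reduces modulo $\hbar$ to the identification $\mathcal{U}_\hbar(\mathfrak{g})/\hbar\,\mathcal{U}_\hbar(\mathfrak{g})\cong\mathcal{U}(\mathfrak{g})$; the transferred Hopf structure is $\Delta_\hbar:=(\alpha\otimes\alpha)\circ\Delta'\circ\alpha^{-1}$, $\varepsilon_\hbar:=\varepsilon'\circ\alpha^{-1}$, $S_\hbar:=\alpha\circ S'\circ\alpha^{-1}$. A Drinfeld twist from $\Delta$ to $\Delta_\hbar$ is an invertible $\mathcal{F}\in(\mathcal{U}(\mathfrak{g})\otimes\mathcal{U}(\mathfrak{g}))[[\hbar]]$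 with $\Delta_\hbar(g)=\mathcal{F}\Delta(g)\mathcal{F}^{-1}$ for all $g$, assumed counital: $(\varepsilon\otimes\mathrm{id})(\mathcal{F})=1=(\mathrm{id}\otimes\varepsilon)(\mathcal{F})$. $\mathcal{F}_{21}$ is $\mathcal{F}$ with tensor factors flipped. An element $\sigma$ as in the claim exists and is unique, and satisfies $\sigma^*=\sigma$. For a Hopf $*$-algebra $H$ with coproduct $\Delta(g)=g_{(1)}\otimes g_{(2)}$ and antipode $S$, an $H$-module algebra is an algebra $\mathcal{X}$ with an action $\triangleright$ of $H$ such that $g\triangleright(xy)=(g_{(1)}\triangleright x)(g_{(2)}\triangleright y)$; an $H$-module $*$-algebra is such an $\mathcal{X}$ with a $*$-structure (conjugate-linear involutive algebra antihomomorphism) satisfying $(g\triangleright x)^*=(Sg)^*\triangleright x^*$ for all $g\in H$, $x\in\mathcal{X}$. ''$\hbar$-adic'' means over $\mathbb{C}[[\hbar]]$ and topologically free (of the form $V[[\hbar]]$). *)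

(* Defs.v *)
From HB Require Import structures.
From mathcomp Require Import all_boot all_order all_algebra.
From mathcomp Require Import boolp reals.
From mathcomp.real_closed Require Import complex.

Set Implicit Arguments.
Unset Strict Implicit.
Unset Printing Implicit Defensive.

Import GRing.Theory Num.Theory.
Local Open Scope ring_scope.
Local Open Scope quotient_scope.

(** Tensor product of two modules over a commutative ring K: formal sums of
    symbols v (x) w modulo the congruence generated by the group axioms,
    biadditivity and K-balancedness. *)

Section TensorQuotient.
Context {K : comNzRingType} (V W : lmodType K).

Inductive tterm : Type :=
| TPure of V & W
| TZero
| TOpp of tterm
| TAdd of tterm & tterm.

Inductive tcong : tterm -> tterm -> Prop :=
| tcong_refl t : tcong t t
| tcong_sym t u : tcong t u -> tcong u t
| tcong_trans t u w : tcong t u -> tcong u w -> tcong t w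
| tcong_opp t t' : tcong t t' -> tcong (TOpp t) (TOpp t')
| tcong_add t t' u u' : tcong t t' -> tcong u u' -> tcong (TAdd t u) (TAdd t' u')
| tcong_addA t u w : tcong (TAdd t (TAdd u w)) (TAdd (TAdd t u) w)
| tcong_addC t u : tcong (TAdd t u) (TAdd u t)
| tcong_add0 t : tcong (TAdd TZero t) t
| tcong_addN t : tcong (TAdd (TOpp t) t) TZero
| tcong_Dl v v' w : tcong (TPure (v + v') w) (TAdd (TPure v w) (TPure v' w))
| tcong_Dr v w w' : tcong (TPure v (w + w')) (TAdd (TPure v w) (TPure v w'))
| tcong_bal a v w : tcong (TPure (a *: v) w) (TPure v (a *: w)).

HB.instance Definition _ := gen_eqMixin tterm.
HB.instance Definition _ := gen_choiceMixin tterm.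

Definition tcongb (t u : tterm) : bool := `[< tcong t u >].

Lemma tcongb_refl : reflexive tcongb.
Proof. by move=> t; apply/asboolP/tcong_refl. Qed.
Lemma tcongb_sym : symmetric tcongb.
Proof. by move=> t u; apply/asboolP/asboolP => /tcong_sym. Qed.
Lemma tcongb_trans : transitive tcongb.
Proof.
by move=> u t w /asboolP tu /asboolP uw; apply/asboolP; apply: tcong_trans uw.
Qed.

Canonical tcong_equiv := EquivRel tcongb tcongb_refl tcongb_sym tcongb_trans.

Definition tensor : Type := {eq_quot tcong_equiv}.
HB.instance Definition _ := Choice.on tensor.
HB.instance Definition _ := EqQuotient.on tensor.

Lemma tpiP (t u : tterm) : tcong t u <-> \pi_tensor t = \pi_tensor u.
Proof. by split=> [tu|/eqmodP/asboolP//]; apply/eqmodP/asboolP. Qed.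

Lemma treprP (t : tterm) : tcong (repr (\pi_tensor t)) t.
Proof. by apply/tpiP; rewrite reprK. Qed.

Definition tpure (v : V) (w : W) : tensor := \pi_tensor (TPure v w).
Definition tzero : tensor := \pi_tensor TZero.
Definition topp := lift_op1 tensor TOpp.
Definition tadd := lift_op2 tensor TAdd.

Lemma topp_pi t : topp (\pi_tensor t) = \pi_tensor (TOpp t).
Proof. by unlock topp; apply/tpiP/tcong_opp/treprP. Qed.
Lemma tadd_pi t u : tadd (\pi_tensor t) (\pi_tensor u) = \pi_tensor (TAdd t u).
Proof. by unlock tadd; apply/tpiP/tcong_add; exact: treprP. Qed.

Lemma taddA : associative tadd.
Proof.
elim/quotW=> t; elim/quotW=> u; elim/quotW=> w.
by rewrite !tadd_pi; apply/tpiP/tcong_addA.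
Qed.
Lemma taddC : commutative tadd.
Proof. by elim/quotW=> t; elim/quotW=> u; rewrite !tadd_pi; apply/tpiP/tcong_addC. Qed.
Lemma tadd0 : left_id tzero tadd.
Proof. by elim/quotW=> t; rewrite tadd_pi; apply/tpiP/tcong_add0. Qed.
Lemma taddN : left_inverse tzero topp tadd.
Proof. by elim/quotW=> t; rewrite topp_pi tadd_pi; apply/tpiP/tcong_addN. Qed.

HB.instance Definition _ := GRing.isZmodule.Build tensor taddA taddC tadd0 taddN.

Lemma piD t u : \pi_tensor (TAdd t u) = \pi_tensor t + \pi_tensor u.
Proof. by rewrite -tadd_pi. Qed.
Lemma piN t : \pi_tensor (TOpp t) = - \pi_tensor t.
Proof. by rewrite -topp_pi. Qed.

Lemma tpureDl v v' w : tpure (v + v') w = tpure v w + tpure v' w.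
Proof. by rewrite -piD; apply/tpiP/tcong_Dl. Qed.
Lemma tpureDr v w w' : tpure v (w + w') = tpure v w + tpure v w'.
Proof. by rewrite -piD; apply/tpiP/tcong_Dr. Qed.
Lemma tpure_bal a v w : tpure (a *: v) w = tpure v (a *: w).
Proof. exact/tpiP/tcong_bal. Qed.

Lemma tensor_ind (P : tensor -> Prop) :
  P 0 -> (forall x, P x -> P (- x)) -> (forall x y, P x -> P y -> P (x + y)) ->
  (forall v w, P (tpure v w)) -> forall x, P x.
Proof.
move=> P0 PN PD Pp; elim/quotW; elim=> [v w| |t Pt|t Pt u Pu]; first exact: Pp.
- exact: P0.
- by rewrite piN; apply: PN.
- by rewrite piD; apply: PD.
Qed.

(** Maps out of the tensor product: [tlift b] sends v (x) w to b v w.  The target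
    is a mere abelian group and b is only required to be biadditive and balanced,
    so that conjugate-linear maps can be lifted too. *)
Section Lift.
Variables (Z : zmodType) (b : V -> W -> Z).

Fixpoint teval (t : tterm) : Z :=
  match t with
  | TPure v w => b v w
  | TZero => 0
  | TOpp t => - teval t
  | TAdd t u => teval t + teval u
  end.

Definition tlift (x : tensor) : Z := teval (repr x).

Definition balanced := [/\ forall w, {morph b^~ w : v v' / v + v'},
  forall v, {morph b v : w w' / w + w'} &
  forall a v w, b (a *: v) w = b v (a *: w)].

Hypothesis bP : balanced.

Lemma teval_cong t u : tcong t u -> teval t = teval u.
Proof.
case: bP => bDl bDr bZ; elim=> //=.
- by move=> ? ? ? _ -> _ ->.
- by move=> ? ? _ ->.
- by move=> ? ? ? ? _ -> _ ->.
- by move=> *; rewrite addrA.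
- by move=> *; rewrite addrC.
- by move=> *; rewrite add0r.
- by move=> *; rewrite addNr.
- by move=> v v' w; exact: bDl.
Qed.

Lemma tlift_pi t : tlift (\pi_tensor t) = teval t.
Proof. exact/teval_cong/treprP. Qed.

Lemma tlift_pure v w : tlift (tpure v w) = b v w.
Proof. exact: tlift_pi. Qed.
Lemma tlift0 : tlift 0 = 0.
Proof. exact: tlift_pi. Qed.
Lemma tliftD x y : tlift (x + y) = tlift x + tlift y.
Proof. by elim/quotW: x => t; elim/quotW: y => u; rewrite -piD !tlift_pi. Qed.
Lemma tliftN x : tlift (- x) = - tlift x.
Proof. by elim/quotW: x => t; rewrite -piN !tlift_pi. Qed.
End Lift.

End TensorQuotient.

Arguments tlift {K V W Z} b x.
Arguments tensor_ind : clear implicits.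

Section TensorModule.
Context {K : comNzRingType} (V W : lmodType K).
Local Notation T := (tensor V W).

Definition tscale (a : K) : T -> T := tlift (fun v w => tpure (a *: v) w).

Lemma tscale_balanced a : balanced (fun (v : V) (w : W) => tpure (a *: v) w).
Proof.
split=> [w v v'|v w w'|c v w]; rewrite ?scalerDr ?tpureDl ?tpureDr //.
by rewrite scalerA mulrC -scalerA tpure_bal.
Qed.

Lemma tscale_pure a v w : tscale a (tpure v w) = tpure (a *: v) w.
Proof. exact/tlift_pure/tscale_balanced. Qed.
Lemma tscaleDr a : {morph tscale a : x y / x + y}.
Proof. exact/tliftD/tscale_balanced. Qed.
Lemma tscaleN a x : tscale a (- x) = - tscale a x.
Proof. exact/tliftN/tscale_balanced. Qed.
Lemma tscale0 a : tscale a 0 = 0.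
Proof. exact/tlift0/tscale_balanced. Qed.

Lemma tscaleA a c x : tscale a (tscale c x) = tscale (a * c) x.
Proof.
elim/tensor_ind: x => [|x IH|x y IHx IHy|v w].
- by rewrite !tscale0.
- by rewrite !tscaleN IH.
- by rewrite !tscaleDr IHx IHy.
- by rewrite !tscale_pure scalerA.
Qed.
Lemma tscale1 : left_id 1 tscale.
Proof.
elim/tensor_ind=> [|x IH|x y IHx IHy|v w].
- by rewrite tscale0.
- by rewrite tscaleN IH.
- by rewrite tscaleDr IHx IHy.
- by rewrite tscale_pure scale1r.
Qed.
Lemma tscaleDl x : {morph tscale^~ x : a c / a + c}.
Proof.
move=> a c; elim/tensor_ind: x => [|x IH|x y IHx IHy|v w].
- by rewrite !tscale0 addr0.
- by rewrite !tscaleN IH opprD.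
- by rewrite !tscaleDr IHx IHy addrACA.
- by rewrite !tscale_pure scalerDl tpureDl.
Qed.

HB.instance Definition _ :=
  GRing.Zmodule_isLmodule.Build K T tscaleA tscale1 tscaleDr tscaleDl.

Lemma tpureZl a v w : a *: tpure v w = tpure (a *: v) w :> T.
Proof. exact: tscale_pure. Qed.
Lemma tpureZr a v w : a *: tpure v w = tpure v (a *: w) :> T.
Proof. by rewrite tpureZl tpure_bal. Qed.
Lemma tpureNl v w : tpure (- v) w = - tpure v w :> T.
Proof. by rewrite -scaleN1r -tpureZl scaleN1r. Qed.
Lemma tpureNr v w : tpure v (- w) = - tpure v w :> T.
Proof. by rewrite -scaleN1r -tpureZr scaleN1r. Qed.
Lemma tpure_balanced : balanced (@tpure K V W).
Proof.
by split=> [w v v'|v w w'|a v w]; [exact: tpureDl|exact: tpureDr|exact: tpure_bal].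
Qed.
End TensorModule.

Section TensorMaps.
Context {K : comNzRingType}.

Definition tmap (V W V' W' : lmodType K) (f : V -> V') (g : W -> W') :
  tensor V W -> tensor V' W' := tlift (fun v w => tpure (f v) (g w)).

Definition tflip (V W : lmodType K) : tensor V W -> tensor W V :=
  tlift (fun v w => tpure w v).

Definition tassoc (V W Z : lmodType K) :
    tensor (tensor V W) Z -> tensor V (tensor W Z) :=
  tlift (fun t z => tlift (fun v w => tpure v (tpure w z)) t).

End TensorMaps.

Section TensorProduct.
Context {K : comNzRingType} (A B : algType K).
Local Notation T := (tensor A B).

Definition tmull (a : A) (b : B) : T -> T :=
  tlift (fun a' b' => tpure (a * a') (b * b')).
Definition tmul (x y : T) : T := tlift (fun a b => tmull a b y) x.
Definition tone : T := tpure 1 1.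

Lemma tmull_balanced a b :
  balanced (fun (a' : A) (b' : B) => tpure (a * a') (b * b')).
Proof.
split=> [w v v'|v w w'|c v w]; rewrite ?mulrDr ?tpureDl ?tpureDr //.
by rewrite -!scalerAr tpure_bal.
Qed.
Lemma tmull_pure a b a' b' : tmull a b (tpure a' b') = tpure (a * a') (b * b').
Proof. exact/tlift_pure/tmull_balanced. Qed.
Lemma tmullD a b x y : tmull a b (x + y) = tmull a b x + tmull a b y.
Proof. exact/tliftD/tmull_balanced. Qed.
Lemma tmullN a b x : tmull a b (- x) = - tmull a b x.
Proof. exact/tliftN/tmull_balanced. Qed.
Lemma tmull0 a b : tmull a b 0 = 0.
Proof. exact/tlift0/tmull_balanced. Qed.

Lemma tmul_balanced y : balanced (fun (a : A) (b : B) => tmull a b y).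
Proof.
split=> [b a a'|a b b'|c a b]; elim/tensor_ind: y => [|x IH|x y IHx IHy|v w];
  rewrite ?tmull0 ?addr0 ?tmullN ?IH ?opprD ?tmullD ?IHx ?IHy //;
  rewrite ?tmull_pure ?mulrDl ?tpureDl ?tpureDr //.
- by rewrite addrACA.
- by rewrite addrACA.
- by rewrite -!scalerAl tpure_bal.
Qed.

Lemma tmul_pure a b y : tmul (tpure a b) y = tmull a b y.
Proof. exact: (tlift_pure (tmul_balanced y)). Qed.
Lemma tmulDl : left_distributive tmul +%R.
Proof. by move=> x x' y; exact: (tliftD (tmul_balanced y)). Qed.
Lemma tmulNl x y : tmul (- x) y = - tmul x y.
Proof. exact: (tliftN (tmul_balanced y)). Qed.
Lemma tmul0l y : tmul 0 y = 0.
Proof. exact: (tlift0 (tmul_balanced y)). Qed.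
Lemma tmulDr : right_distributive tmul +%R.
Proof.
move=> x y y'; elim/tensor_ind: x => [|x IH|x x' IHx IHy|v w].
- by rewrite !tmul0l addr0.
- by rewrite !tmulNl IH opprD.
- by rewrite !tmulDl IHx IHy addrACA.
- by rewrite !tmul_pure tmullD.
Qed.
Lemma tmulNr x y : tmul x (- y) = - tmul x y.
Proof.
elim/tensor_ind: x => [|x IH|x x' IHx IHy|v w].
- by rewrite !tmul0l oppr0.
- by rewrite !tmulNl IH.
- by rewrite !tmulDl IHx IHy opprD.
- by rewrite !tmul_pure tmullN.
Qed.
Lemma tmul0r x : tmul x 0 = 0.
Proof.
elim/tensor_ind: x => [|x IH|x x' IHx IHy|v w].
- by rewrite !tmul0l.
- by rewrite !tmulNl IH oppr0.
- by rewrite !tmulDl IHx IHy addr0.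
- by rewrite !tmul_pure tmull0.
Qed.
Lemma tmulA : associative tmul.
Proof.
move=> x y z; elim/tensor_ind: x => [|x IH|x x' IHx IHy|a b].
- by rewrite !tmul0l.
- by rewrite !tmulNl IH.
- by rewrite !tmulDl IHx IHy.
elim/tensor_ind: y => [|y IH|y y' IHx IHy|a' b'].
- by rewrite tmul0l tmul0r tmul0l.
- by rewrite tmulNl !tmulNr tmulNl IH.
- by rewrite tmulDl !tmulDr tmulDl IHx IHy.
elim/tensor_ind: z => [|z IH|z z' IHx IHy|a'' b''].
- by rewrite !tmul0r.
- by rewrite !tmulNr IH.
- by rewrite !tmulDr IHx IHy.
by rewrite !(tmul_pure, tmull_pure) !mulrA.
Qed.
Lemma tmul1l : left_id tone tmul.
Proof.
elim/tensor_ind=> [|x IH|x x' IHx IHy|a b].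
- by rewrite tmul0r.
- by rewrite tmulNr IH.
- by rewrite tmulDr IHx IHy.
- by rewrite tmul_pure tmull_pure !mul1r.
Qed.
Lemma tmul1r : right_id tone tmul.
Proof.
elim/tensor_ind=> [|x IH|x x' IHx IHy|a b].
- by rewrite tmul0l.
- by rewrite tmulNl IH.
- by rewrite tmulDl IHx IHy.
- by rewrite tmul_pure tmull_pure !mulr1.
Qed.
Lemma tmulZl (a : K) (x y : T) : a *: tmul x y = tmul (a *: x) y.
Proof.
elim/tensor_ind: x => [|x IH|x x' IHx IHy|v w].
- by rewrite scaler0 tmul0l scaler0.
- by rewrite tmulNl !scalerN tmulNl IH.
- by rewrite tmulDl !scalerDr tmulDl IHx IHy.
elim/tensor_ind: y => [|y IH|y y' IHx IHy|a' b'].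
- by rewrite !tmul0r scaler0.
- by rewrite !tmulNr scalerN IH.
- by rewrite !tmulDr scalerDr IHx IHy.
by rewrite !(tmul_pure, tmull_pure, tpureZl) scalerAl.
Qed.
Lemma tmulZr (a : K) (x y : T) : a *: tmul x y = tmul x (a *: y).
Proof.
elim/tensor_ind: x => [|x IH|x x' IHx IHy|v w].
- by rewrite !tmul0l scaler0.
- by rewrite !tmulNl scalerN IH.
- by rewrite !tmulDl scalerDr IHx IHy.
elim/tensor_ind: y => [|y IH|y y' IHx IHy|a' b'].
- by rewrite scaler0 !tmul0r scaler0.
- by rewrite scalerN !tmulNr scalerN IH.
- by rewrite scalerDr !tmulDr scalerDr IHx IHy.
by rewrite !(tmul_pure, tmull_pure, tpureZl) scalerAr.
Qed.
End TensorProduct.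

Section Terms.
Context (K : comNzRingType) (X : Type).

Inductive aterm : Type :=
| AVar of X
| AZero
| AOne
| AOpp of aterm
| AAdd of aterm & aterm
| AScale of K & aterm
| AMul of aterm & aterm.

(** The product m is a parameter, so as to get homomorphisms and
    antihomomorphisms from the same recursion. *)
Fixpoint aeval (A : algType K) (m : A -> A -> A) (f : X -> A) (t : aterm) : A :=
  match t with
  | AVar x => f x
  | AZero => 0
  | AOne => 1
  | AOpp t => - aeval m f t
  | AAdd t u => aeval m f t + aeval m f u
  | AScale a t => a *: aeval m f t
  | AMul t u => m (aeval m f t) (aeval m f u)
  end.

(** Relations are required to hold when all generators are sent to 0: the
    presented algebra is then augmented, in particular 1 <> 0 in it. *)
Record presentation := Presentation {
  prel :> aterm -> aterm -> Prop;
  prel_aug : forall t u, prel t u ->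
    aeval (A := K^o) *%R (fun=> 0) t = aeval (A := K^o) *%R (fun=> 0) u }.

End Terms.

Arguments AVar {K X}.
Arguments AZero {K X}.
Arguments AOne {K X}.

Section Presented.
Context {K : comNzRingType} {X : Type} (P : presentation K X).
Local Notation term := (aterm K X).

Inductive acong : term -> term -> Prop :=
| acong_refl t : acong t t
| acong_sym t u : acong t u -> acong u t
| acong_trans t u w : acong t u -> acong u w -> acong t w
| acong_opp t t' : acong t t' -> acong (AOpp t) (AOpp t')
| acong_add t t' u u' : acong t t' -> acong u u' -> acong (AAdd t u) (AAdd t' u')
| acong_scale a t t' : acong t t' -> acong (AScale a t) (AScale a t')
| acong_mul t t' u u' : acong t t' -> acong u u' -> acong (AMul t u) (AMul t' u')
| acong_addA t u w : acong (AAdd t (AAdd u w)) (AAdd (AAdd t u) w)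
| acong_addC t u : acong (AAdd t u) (AAdd u t)
| acong_add0 t : acong (AAdd AZero t) t
| acong_addN t : acong (AAdd (AOpp t) t) AZero
| acong_scaleA a c t : acong (AScale a (AScale c t)) (AScale (a * c) t)
| acong_scale1 t : acong (AScale 1 t) t
| acong_scaleDr a t u :
    acong (AScale a (AAdd t u)) (AAdd (AScale a t) (AScale a u))
| acong_scaleDl t a c :
    acong (AScale (a + c) t) (AAdd (AScale a t) (AScale c t))
| acong_mulA t u w : acong (AMul t (AMul u w)) (AMul (AMul t u) w)
| acong_mul1l t : acong (AMul AOne t) t
| acong_mul1r t : acong (AMul t AOne) t
| acong_mulDl t u w : acong (AMul (AAdd t u) w) (AAdd (AMul t w) (AMul u w))
| acong_mulDr t u w : acong (AMul t (AAdd u w)) (AAdd (AMul t u) (AMul t w))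
| acong_scaleAl a t u : acong (AScale a (AMul t u)) (AMul (AScale a t) u)
| acong_scaleAr a t u : acong (AScale a (AMul t u)) (AMul t (AScale a u))
| acong_rel t u : P t u -> acong t u.

HB.instance Definition _ := gen_eqMixin term.
HB.instance Definition _ := gen_choiceMixin term.

Definition acongb (t u : term) : bool := `[< acong t u >].

Lemma acongb_refl : reflexive acongb.
Proof. by move=> t; apply/asboolP/acong_refl. Qed.
Lemma acongb_sym : symmetric acongb.
Proof. by move=> t u; apply/asboolP/asboolP => /acong_sym. Qed.
Lemma acongb_trans : transitive acongb.
Proof.
by move=> u t w /asboolP tu /asboolP uw; apply/asboolP; apply: acong_trans uw.
Qed.

Canonical acong_equiv := EquivRel acongb acongb_refl acongb_sym acongb_trans.

Definition presalg : Type := {eq_quot acong_equiv}.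
HB.instance Definition _ := Choice.on presalg.
HB.instance Definition _ := EqQuotient.on presalg.

Lemma apiP (t u : term) : acong t u <-> \pi_presalg t = \pi_presalg u.
Proof. by split=> [tu|/eqmodP/asboolP//]; apply/eqmodP/asboolP. Qed.
Lemma areprP (t : term) : acong (repr (\pi_presalg t)) t.
Proof. by apply/apiP; rewrite reprK. Qed.

Definition agen (x : X) : presalg := \pi_presalg (AVar x).
Definition azero : presalg := \pi_presalg AZero.
Definition aone : presalg := \pi_presalg AOne.
Definition aopp := lift_op1 presalg (@AOpp K X).
Definition aadd := lift_op2 presalg (@AAdd K X).
Definition ascale (a : K) := lift_op1 presalg (AScale a).
Definition amul := lift_op2 presalg (@AMul K X).

Lemma aopp_pi t : aopp (\pi_presalg t) = \pi_presalg (AOpp t).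
Proof. by unlock aopp; apply/apiP/acong_opp/areprP. Qed.
Lemma aadd_pi t u : aadd (\pi_presalg t) (\pi_presalg u) = \pi_presalg (AAdd t u).
Proof. by unlock aadd; apply/apiP/acong_add; exact: areprP. Qed.
Lemma ascale_pi a t : ascale a (\pi_presalg t) = \pi_presalg (AScale a t).
Proof. by unlock ascale; apply/apiP/acong_scale/areprP. Qed.
Lemma amul_pi t u : amul (\pi_presalg t) (\pi_presalg u) = \pi_presalg (AMul t u).
Proof. by unlock amul; apply/apiP/acong_mul; exact: areprP. Qed.

Let simp := (aopp_pi, aadd_pi, ascale_pi, amul_pi).

Lemma aaddA : associative aadd.
Proof.
by elim/quotW=> t; elim/quotW=> u; elim/quotW=> w; rewrite !simp; apply/apiP/acong_addA.
Qed.
Lemma aaddC : commutative aadd.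
Proof. by elim/quotW=> t; elim/quotW=> u; rewrite !simp; apply/apiP/acong_addC. Qed.
Lemma aadd0 : left_id azero aadd.
Proof. by elim/quotW=> t; rewrite !simp; apply/apiP/acong_add0. Qed.
Lemma aaddN : left_inverse azero aopp aadd.
Proof. by elim/quotW=> t; rewrite !simp; apply/apiP/acong_addN. Qed.

HB.instance Definition _ := GRing.isZmodule.Build presalg aaddA aaddC aadd0 aaddN.

Lemma apiD t u : \pi_presalg t + \pi_presalg u = \pi_presalg (AAdd t u).
Proof. exact: aadd_pi. Qed.

Lemma ascaleA a c x : ascale a (ascale c x) = ascale (a * c) x.
Proof. by elim/quotW: x => t; rewrite !simp; apply/apiP/acong_scaleA. Qed.
Lemma ascale1 : left_id 1 ascale.
Proof. by elim/quotW=> t; rewrite !simp; apply/apiP/acong_scale1. Qed.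
Lemma ascaleDr : right_distributive ascale +%R.
Proof.
move=> a; elim/quotW=> t; elim/quotW=> u.
by rewrite !(simp, apiD); apply/apiP/acong_scaleDr.
Qed.
Lemma ascaleDl x : {morph ascale^~ x : a c / a + c}.
Proof.
move=> a c; elim/quotW: x => t.
by rewrite !(simp, apiD); apply/apiP/acong_scaleDl.
Qed.
HB.instance Definition _ :=
  GRing.Zmodule_isLmodule.Build K presalg ascaleA ascale1 ascaleDr ascaleDl.

Lemma apiZ a t : a *: \pi_presalg t = \pi_presalg (AScale a t).
Proof. exact: ascale_pi. Qed.

Lemma amulA : associative amul.
Proof.
by elim/quotW=> t; elim/quotW=> u; elim/quotW=> w; rewrite !simp; apply/apiP/acong_mulA.
Qed.
Lemma amul1l : left_id aone amul.
Proof. by elim/quotW=> t; rewrite !simp; apply/apiP/acong_mul1l. Qed.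
Lemma amul1r : right_id aone amul.
Proof. by elim/quotW=> t; rewrite !simp; apply/apiP/acong_mul1r. Qed.
Lemma amulDl : left_distributive amul +%R.
Proof.
elim/quotW=> t; elim/quotW=> u; elim/quotW=> w.
by rewrite !(simp, apiD); apply/apiP/acong_mulDl.
Qed.
Lemma amulDr : right_distributive amul +%R.
Proof.
elim/quotW=> t; elim/quotW=> u; elim/quotW=> w.
by rewrite !(simp, apiD); apply/apiP/acong_mulDr.
Qed.

Section Eval.
Context (A : algType K) (m : A -> A -> A) (f : X -> A).
Hypothesis m_op : m = *%R \/ m = (fun x y => y * x).
Hypothesis fP : forall t u, P t u -> aeval m f t = aeval m f u.

Lemma aeval_cong t u : acong t u -> aeval m f t = aeval m f u.
Proof.
elim=> //=.
- by move=> ? ? ? _ -> _ ->.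
- by move=> ? ? _ ->.
- by move=> ? ? ? ? _ -> _ ->.
- by move=> ? ? ? _ ->.
- by move=> ? ? ? ? _ -> _ ->.
- by move=> *; rewrite addrA.
- by move=> *; rewrite addrC.
- by move=> *; rewrite add0r.
- by move=> *; rewrite addNr.
- by move=> *; rewrite scalerA.
- by move=> *; rewrite scale1r.
- by move=> *; rewrite scalerDr.
- by move=> *; rewrite scalerDl.
- by move=> *; case: m_op => ->; rewrite mulrA.
- by move=> *; case: m_op => ->; rewrite ?mul1r ?mulr1.
- by move=> *; case: m_op => ->; rewrite ?mul1r ?mulr1.
- by move=> *; case: m_op => ->; rewrite ?mulrDl ?mulrDr.
- by move=> *; case: m_op => ->; rewrite ?mulrDl ?mulrDr.
- by move=> *; case: m_op => ->; [exact: scalerAl|exact: scalerAr].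
- by move=> *; case: m_op => ->; [exact: scalerAr|exact: scalerAl].
Qed.
End Eval.

Lemma aone_neq0 : aone != 0 :> presalg.
Proof.
apply/eqP => /apiP /(aeval_cong (or_introl erefl) (@prel_aug _ _ P)) /= /eqP.
by rewrite oner_eq0.
Qed.

HB.instance Definition _ := GRing.Zmodule_isNzRing.Build presalg
  amulA amul1l amul1r amulDl amulDr aone_neq0.

Lemma ascaleAl (a : K) (x y : presalg) : a *: (x * y) = a *: x * y.
Proof.
elim/quotW: x => t; elim/quotW: y => u.
rewrite -[LHS]/(ascale a (amul _ _)) -[RHS]/(amul (ascale a _) _) !simp.
exact/apiP/acong_scaleAl.
Qed.
HB.instance Definition _ := GRing.Lmodule_isLalgebra.Build K presalg ascaleAl.
Lemma ascaleAr (a : K) (x y : presalg) : a *: (x * y) = x * (a *: y).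
Proof.
elim/quotW: x => t; elim/quotW: y => u.
rewrite -[LHS]/(ascale a (amul _ _)) -[RHS]/(amul _ (ascale a _)) !simp.
exact/apiP/acong_scaleAr.
Qed.
HB.instance Definition _ := GRing.Lalgebra_isAlgebra.Build K presalg ascaleAr.

(** The algebra homomorphism, resp. antihomomorphism, extending f on generators
    (meaningful when f respects the relations). *)
Definition ahom (A : algType K) (f : X -> A) (u : presalg) : A :=
  aeval *%R f (repr u).
Definition aantihom (A : algType K) (f : X -> A) (u : presalg) : A :=
  aeval (fun x y => y * x) f (repr u).

Lemma ahom_pi (A : algType K) (f : X -> A) t :
  (forall t u, P t u -> aeval *%R f t = aeval *%R f u) ->
  ahom f (\pi_presalg t) = aeval *%R f t.
Proof. by move=> fP; apply: (aeval_cong (or_introl erefl) fP); exact: areprP. Qed.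

Lemma aantihom_pi (A : algType K) (f : X -> A) t :
  (forall t u, P t u ->
     aeval (fun x y => y * x) f t = aeval (fun x y => y * x) f u) ->
  aantihom f (\pi_presalg t) = aeval (fun x y => y * x) f t.
Proof. by move=> fP; apply: (aeval_cong (or_intror erefl) fP); exact: areprP. Qed.

End Presented.

(** Tensor products of presented algebras are algebras (nontrivial because of the
    augmentations). *)
Section PresentedTensor.
Context {K : comNzRingType} {X Y : Type}
        (P : presentation K X) (Q : presentation K Y).
Local Notation T := (tensor (presalg P) (presalg Q)).

Lemma tone_neq0 : tone (presalg P) (presalg Q) != 0.
Proof.
pose eP := ahom (P := P) (A := K^o) (fun=> 0).
pose eQ := ahom (P := Q) (A := K^o) (fun=> 0).
have ePpi t : eP (\pi_(presalg P) t) = aeval (A := K^o) *%R (fun=> 0) t.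
  exact/ahom_pi/prel_aug.
have eQpi t : eQ (\pi_(presalg Q) t) = aeval (A := K^o) *%R (fun=> 0) t.
  exact/ahom_pi/prel_aug.
have bal : balanced (fun a b => eP a * eQ b : K).
  split=> [b|a|c a b].
  - elim/quotW=> t; elim/quotW=> u; rewrite apiD !ePpi.
    exact: mulrDl.
  - elim/quotW=> t; elim/quotW=> u; rewrite apiD !eQpi.
    exact: mulrDr.
  - elim/quotW: a => t; elim/quotW: b => u.
    rewrite !apiZ.
    rewrite !ePpi !eQpi /= -[c *: aeval _ _ t]/(c * _) -[c *: aeval _ _ u]/(c * _).
    by rewrite mulrA [c * _]mulrC.
apply/eqP => /(congr1 (tlift (fun a b => eP a * eQ b : K))) /eqP.
rewrite (tlift_pure bal) (tlift0 bal).
have -> : eP 1 = 1 by exact: (ePpi AOne).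
have -> : eQ 1 = 1 by exact: (eQpi AOne).
by rewrite mulr1 oner_eq0.
Qed.

HB.instance Definition _ := GRing.Zmodule_isNzRing.Build T
  (@tmulA _ _ _) (@tmul1l _ _ _) (@tmul1r _ _ _) (@tmulDl _ _ _) (@tmulDr _ _ _)
  tone_neq0.
HB.instance Definition _ :=
  GRing.Lmodule_isLalgebra.Build K T (@tmulZl _ _ _).
HB.instance Definition _ :=
  GRing.Lalgebra_isAlgebra.Build K T (@tmulZr _ _ _).

Lemma tpureM a b a' b' : (tpure a b : T) * tpure a' b' = tpure (a * a') (b * b').
Proof. by rewrite -[LHS]/(tmul _ _) tmul_pure tmull_pure. Qed.

End PresentedTensor.
(** V[[h]] *)

Definition hser (V : Type) : Type := nat -> V.

HB.instance Definition _ (V : Type) := gen_eqMixin (hser V).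
HB.instance Definition _ (V : Type) := gen_choiceMixin (hser V).

Definition hconst {V : zmodType} (v : V) : hser V := fun n => if n is 0 then v else 0.
Definition hmap {V W : Type} (f : V -> W) (x : hser V) : hser W := fun n => f (x n).

Lemma conv_exchange (Z : zmodType) (G : nat -> nat -> nat -> Z) n :
  \sum_(i < n.+1) \sum_(j < i.+1) G j (i - j)%N (n - i)%N =
  \sum_(j < n.+1) \sum_(k < (n - j).+1) G j k (n - j - k)%N.
Proof.
transitivity (\sum_(0 <= i < n.+1) \sum_(0 <= j < n.+1 | (j < i.+1)%N)
                G j (i - j)%N (n - i)%N).
  rewrite big_mkord; apply: eq_bigr => i _.
  rewrite -(big_mkord xpredT (fun j => G j (i - j)%N (n - i)%N)).
  exact: big_nat_widen.
rewrite (exchange_big_dep_nat xpredT) //= big_mkord; apply: eq_bigr => j _.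
have jn : (j <= n)%N by rewrite -ltnS.
rewrite -(big_mkord xpredT (fun k => G j k (n - j - k)%N)).
rewrite -subSn // -[in RHS](addnK j 0%N) add0n -{1}(add0n (j : nat)).
rewrite [LHS](_ : _ = \sum_(j <= i < n.+1) G j (i - j)%N (n - i)%N); last first.
  by rewrite [RHS](big_nat_widenl _ 0%N) //; apply: eq_bigl => i; rewrite ltnS.
rewrite -{1}(add0n (j : nat)) big_addn.
by rewrite subnn; apply: eq_bigr => k _; rewrite addnK -subnDA [(j + k)%N]addnC.
Qed.

Section HSeriesZmod.
Variable V : zmodType.
Implicit Types x y z : hser V.

Definition hzero : hser V := fun=> 0.
Definition hopp x : hser V := fun n => - x n.
Definition hadd x y : hser V := fun n => x n + y n.

Lemma haddA : associative hadd.
Proof. by move=> x y z; apply/funext => n; exact: addrA. Qed.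
Lemma haddC : commutative hadd.
Proof. by move=> x y; apply/funext => n; exact: addrC. Qed.
Lemma hadd0 : left_id hzero hadd.
Proof. by move=> x; apply/funext => n; exact: add0r. Qed.
Lemma haddN : left_inverse hzero hopp hadd.
Proof. by move=> x; apply/funext => n; exact: addNr. Qed.

HB.instance Definition _ := GRing.isZmodule.Build (hser V) haddA haddC hadd0 haddN.

Lemma hserD x y n : (x + y) n = x n + y n. Proof. by []. Qed.
Lemma hserN x n : (- x) n = - x n. Proof. by []. Qed.
Lemma hser0 n : (0 : hser V) n = 0. Proof. by []. Qed.
End HSeriesZmod.

Section HSeriesRing.
Variable A : nzRingType.
Implicit Types x y z : hser A.

Definition hone : hser A := hconst 1.
Definition hmul x y : hser A := fun n => \sum_(i < n.+1) x i * y (n - i)%N.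

Lemma hmulA : associative hmul.
Proof.
move=> x y z; apply/funext => n; rewrite /hmul.
under eq_bigr => i _ do rewrite mulr_sumr.
under [RHS]eq_bigr => i _ do rewrite mulr_suml.
rewrite (conv_exchange (fun i j k => x i * y j * z k)).
by apply: eq_bigr => i _; apply: eq_bigr => j _; rewrite mulrA.
Qed.
Lemma hmul1l : left_id hone hmul.
Proof.
move=> x; apply/funext => n; rewrite /hmul big_ord_recl /= mul1r subn0.
by rewrite big1 ?addr0 // => i _; rewrite mul0r.
Qed.
Lemma hmul1r : right_id hone hmul.
Proof.
move=> x; apply/funext => n; rewrite /hmul big_ord_recr /= subnn mulr1.
rewrite big1 ?add0r // => i _; rewrite /hone /hconst.
by case: (n - i)%N (subn_gt0 i n) => [|m _]; rewrite ?mulr0 ?ltn_ord.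
Qed.
Lemma hmulDl : left_distributive hmul +%R.
Proof.
move=> x y z; apply/funext => n; rewrite hserD -big_split.
by apply: eq_bigr => i _; rewrite mulrDl.
Qed.
Lemma hmulDr : right_distributive hmul +%R.
Proof.
move=> x y z; apply/funext => n; rewrite hserD -big_split.
by apply: eq_bigr => i _; rewrite mulrDr.
Qed.
Lemma hone_neq0 : hone != 0.
Proof. by apply/eqP => /(congr1 (@^~ 0%N)) /eqP; rewrite oner_eq0. Qed.

HB.instance Definition _ := GRing.Zmodule_isNzRing.Build (hser A)
  hmulA hmul1l hmul1r hmulDl hmulDr hone_neq0.

Lemma hserM x y n : (x * y) n = \sum_(i < n.+1) x i * y (n - i)%N.
Proof. by []. Qed.
End HSeriesRing.

Section HSeriesModule.
Variable K : comNzRingType.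

Lemma hmulC : commutative (@hmul K).
Proof.
move=> x y; apply/funext => n; rewrite /hmul (reindex_inj rev_ord_inj) /=.
apply: eq_bigr => i _; have i_le : (i <= n)%N by rewrite -ltnS.
by rewrite subSS subKn // mulrC.
Qed.
HB.instance Definition _ := GRing.PzRing_hasCommutativeMul.Build (hser K) hmulC.

Section Module.
Variable V : lmodType K.

Definition hscale (s : hser K) (x : hser V) : hser V :=
  fun n => \sum_(i < n.+1) s i *: x (n - i)%N.

Lemma hscaleA s t x : hscale s (hscale t x) = hscale (s * t) x.
Proof.
apply/funext => n; rewrite /hscale.
under eq_bigr => i _ do rewrite scaler_sumr.
under [RHS]eq_bigr => i _ do rewrite hserM scaler_suml.
rewrite (conv_exchange (fun i j k => (s i * t j) *: x k)).
by apply: eq_bigr => i _; apply: eq_bigr => j _; rewrite scalerA.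
Qed.
Lemma hscale1 : left_id 1 hscale.
Proof.
move=> x; apply/funext => n; rewrite /hscale big_ord_recl /= scale1r subn0.
by rewrite big1 ?addr0 // => i _; rewrite scale0r.
Qed.
Lemma hscaleDr : right_distributive hscale +%R.
Proof.
move=> s x y; apply/funext => n; rewrite hserD -big_split.
by apply: eq_bigr => i _; rewrite scalerDr.
Qed.
Lemma hscaleDl x : {morph hscale^~ x : s t / s + t}.
Proof.
move=> s t; apply/funext => n; rewrite hserD -big_split.
by apply: eq_bigr => i _; rewrite scalerDl.
Qed.
HB.instance Definition _ := GRing.Zmodule_isLmodule.Build (hser K) (hser V)
  hscaleA hscale1 hscaleDr hscaleDl.

Lemma hserZ (s : hser K) (x : hser V) n :
  (s *: x) n = \sum_(i < n.+1) s i *: x (n - i)%N.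
Proof. by []. Qed.
End Module.

Section Algebra.
Variable A : algType K.

Lemma hscaleAl (s : hser K) (x y : hser A) : s *: (x * y) = s *: x * y.
Proof.
apply/funext => n; rewrite hserZ hserM.
under eq_bigr => i _ do rewrite hserM scaler_sumr.
under [RHS]eq_bigr => i _ do rewrite hserZ mulr_suml.
rewrite (conv_exchange (fun i j k => s i *: x j * y k)).
by apply: eq_bigr => i _; apply: eq_bigr => j _; rewrite scalerAl.
Qed.
HB.instance Definition _ := GRing.Lmodule_isLalgebra.Build (hser K) (hser A) hscaleAl.
Lemma hscaleAr (s : hser K) (x y : hser A) : s *: (x * y) = x * (s *: y).
Proof.
apply/funext => n; rewrite hserZ hserM.
under eq_bigr => i _ do rewrite hserM scaler_sumr.
under [RHS]eq_bigr => i _ do rewrite hserZ mulr_sumr.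
rewrite -(conv_exchange (fun i j k => s i *: (x j * y k))).
rewrite -(conv_exchange (fun i j k => x i * (s j *: y k))).
apply: eq_bigr => i _; rewrite (reindex_inj rev_ord_inj) /=.
apply: eq_bigr => j _; have j_le : (j <= i)%N by rewrite -ltnS.
by rewrite subSS subKn // scalerAr.
Qed.
HB.instance Definition _ := GRing.Lalgebra_isAlgebra.Build (hser K) (hser A) hscaleAr.
End Algebra.

End HSeriesModule.
(** The completed tensor product of V[[h]] and W[[h]] is (V (x) W)[[h]]. *)

Section CompletedTensor.
Context {K : comNzRingType}.

Definition hpure (V W : lmodType K) (x : hser V) (y : hser W) : hser (tensor V W) :=
  fun n => \sum_(i < n.+1) tpure (x i) (y (n - i)%N).

(** The h-linear continuous map (V (x) W)[[h]] -> Z[[h]] with v (x) w |-> b v w. *)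
Definition hlift (V W : lmodType K) (Z : zmodType) (b : V -> W -> hser Z)
    (t : hser (tensor V W)) : hser Z :=
  fun n => \sum_(i < n.+1) tlift b (t i) (n - i)%N.

Definition htens (V W V' W' : lmodType K) (f : hser V -> hser V')
    (g : hser W -> hser W') : hser (tensor V W) -> hser (tensor V' W') :=
  hlift (fun v w => hpure (f (hconst v)) (g (hconst w))).

(** Componentwise action (a (x) b) . (x (x) y) = (a . x) (x) (b . y). *)
Definition hact2 (A V : lmodType K) (act : hser A -> hser V -> hser V)
    (F : hser (tensor A A)) (t : hser (tensor V V)) : hser (tensor V V) :=
  hlift (fun a b => htens (act (hconst a)) (act (hconst b)) t) F.

End CompletedTensor.

Record lieAlgebra (K : fieldType) := LieAlgebra {
  lie_sort :> vectType K;
  lie : lie_sort -> lie_sort -> lie_sort;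
  lie_linearl : forall z a x y, lie (a *: x + y) z = a *: lie x z + lie y z;
  lie_linearr : forall z a x y, lie z (a *: x + y) = a *: lie z x + lie z y;
  lie_alt : forall x, lie x x = 0;
  lie_jacobi : forall x y z,
    lie x (lie y z) + lie y (lie z x) + lie z (lie x y) = 0 }.

Section Lie.
Context {K : fieldType} (g : lieAlgebra K).

Definition lie_ideal (I : {vspace g}) := forall x y : g, y \in I -> lie x y \in I.

Definition lie_derived (I : {vspace g}) : {vspace g} :=
  <<[seq lie x y | x <- vbasis I, y <- vbasis I]>>%VS.

Definition lie_solvable (I : {vspace g}) := exists n, iter n lie_derived I = 0%VS.

Definition semisimple :=
  forall I : {vspace g}, lie_ideal I -> lie_solvable I -> I = 0%VS.

Inductive lie_rel : aterm K g -> aterm K g -> Prop :=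
| lie_rel_add x y : lie_rel (AVar (x + y)) (AAdd (AVar x) (AVar y))
| lie_rel_scale a x : lie_rel (AVar (a *: x)) (AScale a (AVar x))
| lie_rel_lie x y : lie_rel (AVar (lie x y))
    (AAdd (AMul (AVar x) (AVar y)) (AOpp (AMul (AVar y) (AVar x)))).

Lemma lie_rel_aug t u : lie_rel t u ->
  aeval (A := K^o) *%R (fun=> 0) t = aeval (A := K^o) *%R (fun=> 0) u.
Proof. by case=> [x y|a x|x y] /=; rewrite ?addr0 ?scaler0 ?mul0r ?oppr0 ?addr0. Qed.

Definition lie_presentation := Presentation lie_rel_aug.

End Lie.

Notation enveloping g := (presalg (lie_presentation g)).

Section Enveloping.
Context {K : fieldType} (g : lieAlgebra K).

Local Notation U := (enveloping g).

Definition uincl (x : g) : U := agen (lie_presentation g) x.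

Definition udelta : U -> tensor U U :=
  ahom (fun x => tpure (uincl x) 1 + tpure 1 (uincl x)).
Definition ueps : U -> K := ahom (A := K^o) (fun=> 0).
Definition uS : U -> U := aantihom (fun x => - uincl x).

Lemma uinclD x y : uincl (x + y) = uincl x + uincl y.
Proof. by rewrite apiD; apply/apiP/acong_rel/lie_rel_add. Qed.
Lemma uinclZ a x : uincl (a *: x) = a *: uincl x.
Proof. by rewrite apiZ; apply/apiP/acong_rel/lie_rel_scale. Qed.
Lemma uincl_lie x y : uincl (lie x y) = uincl x * uincl y - uincl y * uincl x.
Proof.
transitivity (\pi_(U) (AAdd (AMul (AVar x) (AVar y))
                                (AOpp (AMul (AVar y) (AVar x))))).
  exact/apiP/acong_rel/lie_rel_lie.
by rewrite -apiD -amul_pi -aopp_pi -amul_pi.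
Qed.

Lemma udelta_uincl x : udelta (uincl x) = tpure (uincl x) 1 + tpure 1 (uincl x).
Proof.
apply: ahom_pi => t u; case=> {t u x} [x y|a x|x y] /=.
- by rewrite uinclD tpureDl tpureDr addrACA.
- by rewrite uinclZ scalerDr tpureZl tpureZr.
- rewrite uincl_lie tpureDl tpureDr tpureNl tpureNr.
  rewrite !mulrDl !mulrDr !tpureM !mul1r !mulr1 !opprD.
  move: (tpure _ _) (tpure _ _) (tpure 1 _) (tpure 1 _) (tpure _ 1) (tpure _ 1).
  move=> q p e c b a; rewrite (addrC q c) (addrACA a p) (addrC (- p) (- e)).
  rewrite (addrACA (- b)) [RHS]addrACA -(opprD q p) (addrC q p) subrr addr0.
  exact: addrACA.
Qed.

Lemma ueps_uincl x : ueps (uincl x) = 0.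
Proof. exact: (ahom_pi (A := K^o) (AVar x) (@prel_aug _ _ _)). Qed.

Lemma uS_uincl x : uS (uincl x) = - uincl x.
Proof.
apply: aantihom_pi => t u; case=> {t u x} [x y|a x|x y] /=.
- by rewrite uinclD opprD.
- by rewrite uinclZ scalerN.
- by rewrite uincl_lie !mulrNN opprB.
Qed.

End Enveloping.

(** A topologically free Hopf algebra over K[[h]]: a K[[h]]-module V[[h]] whose
    product (not assumed to come from a product on V) is a K[[h]]-linear map on the
    completed tensor product.  Any K[[h]]-linear map V[[h]] -> W[[h]] is
    continuous. *)
Record hadicHopf (K : comNzRingType) := HadicHopf {
  hh_sort :> lmodType K;
  hh_mul : {linear hser (tensor hh_sort hh_sort) -> hser hh_sort};
  hh_one : hser hh_sort;
  hh_delta : {linear hser hh_sort -> hser (tensor hh_sort hh_sort)};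
  hh_eps : {linear hser hh_sort -> (hser K)^o};
  hh_S : {linear hser hh_sort -> hser hh_sort};
  hh_prod := fun x y => hh_mul (hpure x y);
  hh_mulA : associative hh_prod;
  hh_mul1l : left_id hh_one hh_prod;
  hh_mul1r : right_id hh_one hh_prod;
  hh_delta1 : hh_delta hh_one = hpure hh_one hh_one;
  hh_deltaM : forall x y,
    hh_delta (hh_prod x y) = hact2 hh_prod (hh_delta x) (hh_delta y);
  hh_eps1 : hh_eps hh_one = 1;
  hh_epsM : forall x y, hh_eps (hh_prod x y) = hh_eps x * hh_eps y;
  hh_coassoc : forall x, hmap (@tassoc K hh_sort hh_sort hh_sort)
      (htens hh_delta id (hh_delta x)) = htens id hh_delta (hh_delta x);
  hh_counitl : forall x,
    hlift (fun v w => hh_eps (hconst v) *: hconst w) (hh_delta x) = x;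
  hh_counitr : forall x,
    hlift (fun v w => hh_eps (hconst w) *: hconst v) (hh_delta x) = x;
  hh_antipodel : forall x,
    hh_mul (htens hh_S id (hh_delta x)) = hh_eps x *: hh_one;
  hh_antipoder : forall x,
    hh_mul (htens id hh_S (hh_delta x)) = hh_eps x *: hh_one }.

Section DrinfeldJimbo.
Context {C : numClosedFieldType}.

(** e^{h a}, for a in a C-algebra. *)
Definition hexp (A : algType C) (a : A) : hser A := fun n => (n`!)%:R^-1 *: a ^+ n.

Definition qexp (c : C) : hser C := hexp (c : C^o).

(** The symmetric q-binomial coefficient [n choose k]_q at q = e^{h c}, via the
    q-Pascal rule. *)
Fixpoint qbinom (c : C) (n k : nat) : hser C :=
  match n, k with
  | _, 0%N => 1
  | 0%N, _.+1 => 0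
  | n.+1, k.+1 => qexp (k.+1%:R * c) * qbinom c n k.+1
                  + qexp (- ((n - k)%:R * c)) * qbinom c n k
  end.

Section CartanMatrix.
Context {l : nat} (A : 'M[int]_l) (d : 'I_l -> C).

Definition serre_exp (i j : 'I_l) : nat := `|1 - A i j|%N.

(** A is the Cartan matrix of g, witnessed by Chevalley generators, and d
    symmetrizes A.  The positive numbers d i are half the squared lengths of the
    simple roots; the normalization on each simple factor is left free, so that
    both q = e^h and q = e^{h/2} are covered. *)
Definition cartan_datum (g : lieAlgebra C) :=
  [/\ (forall i, A i i = 2),
      (forall i j, i != j -> A i j <= 0),
      (forall i, 0 < d i),
      (forall i j, d i * (A i j)%:~R = d j * (A j i)%:~R)
    & exists h e f : 'I_l -> g,
      [/\ free [tuple h i | i < l],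
          (forall i j, lie (h i) (h j) = 0),
          (forall i j, lie (h i) (e j) = (A i j)%:~R *: e j /\
                       lie (h i) (f j) = - (A i j)%:~R *: f j),
          (forall i j, lie (e i) (f j) = if i == j then h i else 0)
        & (forall i j, i != j -> iter (serre_exp i j) (lie (e i)) (e j) = 0 /\
                                 iter (serre_exp i j) (lie (f i)) (f j) = 0)
          /\
          forall W : {vspace g}, (forall i, e i \in W /\ f i \in W) ->
            (forall x y, x \in W -> y \in W -> lie x y \in W) -> W = fullv]].

End CartanMatrix.

Inductive dj_gen (l : nat) : Type := GenH of 'I_l | GenE of 'I_l | GenF of 'I_l.

Lemma free_rel_aug (X : Type) (t u : aterm C X) : False ->
  aeval (A := C^o) *%R (fun=> 0) t = aeval (A := C^o) *%R (fun=> 0) u.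
Proof. by []. Qed.

Definition free_presentation (X : Type) := Presentation (@free_rel_aug X).

Section Relations.
Context {l : nat} (A : 'M[int]_l) (d : 'I_l -> C).

Local Notation FA := (presalg (free_presentation (dj_gen l))).

Definition genH (i : 'I_l) : FA := agen _ (GenH i).
Definition genE (i : 'I_l) : FA := agen _ (GenE i).
Definition genF (i : 'I_l) : FA := agen _ (GenF i).

Local Notation H i := (hconst (genH i)).
Local Notation E i := (hconst (genE i)).
Local Notation F i := (hconst (genF i)).

Definition djK (i : 'I_l) : hser FA := hexp (d i *: genH i).
Definition djK' (i : 'I_l) : hser FA := hexp (- d i *: genH i).

Definition q_serre (i : 'I_l) (m : nat) (x y : hser FA) : hser FA :=
  \sum_(k < m.+1) ((-1) ^+ k * qbinom (d i) m k) *: (x ^+ k * y * x ^+ (m - k)).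

(** The elements to be set to 0.  In [dj_EF], s is the quotient of K_i - K_i^-1 by
    q_i - q_i^-1: both are divisible by h, the latter exactly once, so s exists and
    is unique. *)
Inductive dj_rel : hser FA -> Prop :=
| dj_HH i j : dj_rel (H i * H j - H j * H i)
| dj_HE i j : dj_rel (H i * E j - E j * H i - hconst ((A i j)%:~R *: genE j))
| dj_HF i j : dj_rel (H i * F j - F j * H i + hconst ((A i j)%:~R *: genF j))
| dj_EF i j s : (qexp (d i) - qexp (- d i)) *: s = djK i - djK' i ->
    dj_rel (E i * F j - F j * E i - (if i == j then s else 0))
| dj_serreE i j : i != j -> dj_rel (q_serre i (serre_exp A i j) (E i) (E j))
| dj_serreF i j : i != j -> dj_rel (q_serre i (serre_exp A i j) (F i) (F j)).

Definition two_sided_ideal (B : nzRingType) (I : B -> Prop) :=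
  [/\ I 0, (forall x y, I x -> I y -> I (x + y))
    & (forall a x b, I x -> I (a * x * b))].

Definition dj_ideal (x : hser FA) := forall I : hser FA -> Prop,
  two_sided_ideal I -> (forall r, dj_rel r -> I r) -> I x.

Definition hclosure (V : Type) (I : hser V -> Prop) (x : hser V) :=
  forall n, exists2 y, I y & forall k, (k < n)%N -> x k = y k.

(** D is the algebra topologically generated by H_i, E_i, F_i subject to the above
    relations, i.e. the quotient of C<H_i, E_i, F_i>[[h]] by the h-adic closure of
    the ideal they generate, with its standard Hopf structure. *)
Definition drinfeld_jimbo (D : hadicHopf C) :=
  exists pr : {linear hser FA -> hser D},
  [/\ pr 1 = hh_one D /\ (forall x y, pr (x * y) = hh_prod (pr x) (pr y)),
      (forall y, exists x, pr x = y),
      (forall x, pr x = 0 <-> hclosure dj_ideal x)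
    & forall i,
      [/\ [/\ hh_delta D (pr (H i)) =
                hpure (pr (H i)) (hh_one D) + hpure (hh_one D) (pr (H i)),
              hh_delta D (pr (E i)) =
                hpure (pr (E i)) (pr (djK i)) + hpure (hh_one D) (pr (E i))
            & hh_delta D (pr (F i)) =
                hpure (pr (F i)) (hh_one D) + hpure (pr (djK' i)) (pr (F i))],
          [/\ hh_eps D (pr (H i)) = 0, hh_eps D (pr (E i)) = 0
            & hh_eps D (pr (F i)) = 0]
        & [/\ hh_S D (pr (H i)) = - pr (H i),
              hh_S D (pr (E i)) = - pr (E i * djK' i)
            & hh_S D (pr (F i)) = - pr (djK i * F i)]]].

End Relations.

Definition drinfeld_jimbo_of (g : lieAlgebra C) (D : hadicHopf C) :=
  exists l (A : 'M[int]_l) (d : 'I_l -> C),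
    cartan_datum A d g /\ drinfeld_jimbo A d D.

End DrinfeldJimbo.

Section Star.
Context {C : numClosedFieldType}.

(** h is real: h^* = h. *)
Definition hconj (s : hser C) : hser C := hmap Num.conj s.

Definition hconj_linear (V : lmodType C) (st : hser V -> hser V) :=
  forall s x y, st (s *: x + y) = hconj s *: st x + st y.

Definition hadic_hopf_star (D : hadicHopf C) (st : hser D -> hser D) :=
  [/\ hconj_linear st, involutive st,
      (forall x y, st (hh_prod x y) = hh_prod (st y) (st x))
    & (forall x, hh_delta D (st x) = htens st st (hh_delta D x))].

Context (g : lieAlgebra C).
Local Notation U := (enveloping g).

Definition hopf_star (st : U -> U) :=
  [/\ (forall a x y, st (a *: x + y) = Num.conj a *: st x + st y), involutive st,
      (forall x y, st (x * y) = st y * st x)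
    & (forall x, udelta (st x) = tmap st st (udelta x))].

(** p identifies D / hD with U(g) as Hopf *-algebras; the class of x in D modulo h
    is its coefficient x 0. *)
Definition hopf_star_reduction (D : hadicHopf C) (stD : hser D -> hser D)
    (st : U -> U) (p : {linear D -> U}) :=
  [/\ bijective p,
      p (hh_one D 0%N) = 1 /\
        (forall x y, p (hh_prod x y 0%N) = p (x 0%N) * p (y 0%N)),
      (forall x, tmap p p (hh_delta D x 0%N) = udelta (p (x 0%N))),
      (forall x, (hh_eps D x : hser C) 0%N = ueps (p (x 0%N))) /\
        (forall x, p (hh_S D x 0%N) = uS (p (x 0%N)))
    & (forall x, p (stD x 0%N) = st (p (x 0%N)))].

(** alpha is an isomorphism of *-algebras onto U(g)[[h]], with inverse alpha', that
    reduces to p modulo h. *)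
Definition star_algebra_iso (D : hadicHopf C) (stD : hser D -> hser D)
    (st : U -> U) (p : {linear D -> U})
    (alpha : {linear hser D -> hser U}) (alpha' : hser U -> hser D) :=
  [/\ cancel alpha alpha' /\ cancel alpha' alpha,
      alpha (hh_one D) = 1,
      (forall x y, alpha (hh_prod x y) = alpha x * alpha y),
      (forall x, alpha (stD x) = hmap st (alpha x))
    & (forall x, alpha x 0%N = p (x 0%N))].

Record hopfStarData := HopfStarData {
  hs_delta : hser U -> hser (tensor U U);
  hs_eps : hser U -> hser C;
  hs_S : hser U -> hser U;
  hs_star : hser U -> hser U }.

Definition classical_hopf (st : U -> U) : hopfStarData :=
  HopfStarData (hmap (@udelta C g)) (hmap (@ueps C g)) (hmap (@uS C g)) (hmap st).

Definition transferred_hopf (D : hadicHopf C) (st : U -> U)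
    (alpha : hser D -> hser U) (alpha' : hser U -> hser D) : hopfStarData :=
  HopfStarData (fun x => htens alpha alpha (hh_delta D (alpha' x)))
               (fun x => hh_eps D (alpha' x))
               (fun x => alpha (hh_S D (alpha' x)))
               (hmap st).

Definition inverses (B : nzRingType) (x y : B) := x * y = 1 /\ y * x = 1.

Definition inverse (B : nzRingType) (x : B) : B :=
  if pselect (exists y, inverses x y) is left ex then projT1 (cid ex) else x.

Definition drinfeld_twist (H : hopfStarData) (F : hser (tensor U U)) :=
  [/\ exists F', inverses F F',
      (forall x, hs_delta H x = F * hmap (@udelta C g) x * inverse F),
      hmap (tlift (fun a b : U => ueps a *: b)) F = 1
    & hmap (tlift (fun a b : U => ueps b *: a)) F = 1].

Definition real_twist (st : U -> U) (F : hser (tensor U U)) :=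
  hmap (tmap st st) F = hmap (tmap (@uS C g) (@uS C g)) (hmap (@tflip C U U) F).

Definition antipode_twist (H : hopfStarData) (sigma : hser U) :=
  [/\ sigma 0%N = 1,
      (forall x, hs_S H x = sigma * hmap (@uS C g) x * inverse sigma)
    & hs_delta H sigma = hpure sigma sigma].

Section ModuleAlgebra.
Context (H : hopfStarData) (W : lmodType C).
Variables (act : hser U -> hser W -> hser W)
          (mu : hser (tensor W W) -> hser W) (stX : hser W -> hser W).

Definition hadic_action :=
  [/\ (forall x s a b, act (s *: a + b) x = s *: act a x + act b x),
      (forall a s x y, act a (s *: x + y) = s *: act a x + act a y),
      (forall x, act 1 x = x)
    & (forall a b x, act (a * b) x = act a (act b x))].

(** The product is not assumed to be associative: the product deformed by a twist
    that is not a 2-cocycle need not be.  See [module_algebra_unit] for units. *)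
Definition module_star_algebra :=
  [/\ hadic_action,
      (forall s t u, mu (s *: t + u) = s *: mu t + mu u),
      (forall a x y,
         act a (mu (hpure x y)) = mu (hact2 act (hs_delta H a) (hpure x y))),
      [/\ hconj_linear stX, involutive stX
        & forall x y, stX (mu (hpure x y)) = mu (hpure (stX y) (stX x))]
    & (forall a x, stX (act a x) = act (hs_star H (hs_S H a)) (stX x))].

Definition module_algebra_unit (e : hser W) :=
  (forall x, mu (hpure e x) = x /\ mu (hpure x e) = x) /\
  (forall a, act a e = hs_eps H a *: e).

End ModuleAlgebra.

Definition twisted_mul (W : lmodType C) (act : hser U -> hser W -> hser W)
    (mu : hser (tensor W W) -> hser W) (F : hser (tensor U U)) :
    hser (tensor W W) -> hser W :=
  fun t => mu (hact2 act (inverse F) t).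

Definition twisted_star (W : lmodType C) (act : hser U -> hser W -> hser W)
    (stX : hser W -> hser W) (sigma : hser U) : hser W -> hser W :=
  fun x => act (inverse sigma) (stX x).

End Star.

(* Main.v *)
(** The element sigma is group-like for the twisted coproduct, so the antipode
    axiom gives S sigma = sigma^-1.  Reality of F and the twist relation yield
    the antimultiplicativity of the new star; involutivity and compatibility
    with the action reduce to sigma^* = sigma.  For the latter, the identity
    S' * S' * = id (uniqueness of convolution inverses, applied to the
    antihomomorphism S_h = sigma S sigma^-1) says that d = (sigma^* )^-1 sigma
    is central; d is group-like, also for the undeformed coproduct since it is
    central, and its first nonzero coefficient beyond 1 is a central primitive
    element of U(g).  Primitive elements lie in g because the Adams operation
    m o Delta acts as 2^n on the n-th graded piece of the standard filtration
    (no PBW theorem is needed), and the adjoint representation then shows that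
    this coefficient comes from the centre of g, which is trivial. *)

Require Import Defs.
From HB Require Import structures.
From mathcomp Require Import all_boot all_order all_algebra.
From mathcomp Require Import boolp reals.
From mathcomp.real_closed Require Import complex.

Set Implicit Arguments.
Unset Strict Implicit.
Unset Printing Implicit Defensive.

Import GRing.Theory Num.Theory.
Local Open Scope ring_scope.
Local Open Scope quotient_scope.

(** * h-adic maps *)

Section Hadic.

Definition hshift (V : zmodType) (x : hser V) : hser V :=
  fun n => if n is m.+1 then x m else 0.

(** Continuity is not demanded separately: commuting with multiplication by h already makes the n-th
    coefficient of [f x] depend on the coefficients of [x] up to n only. *)
Definition hadic (V W : zmodType) (f : hser V -> hser W) :=
  {morph f : x y / x + y} /\ {morph f : x / hshift x}.

Lemma hadicD (V W : zmodType) (f : hser V -> hser W) : hadic f ->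
  {morph f : x y / x + y}.
Proof. by case. Qed.

Lemma hadic0 (V W : zmodType) (f : hser V -> hser W) : hadic f -> f 0 = 0.
Proof. by case=> fD _; apply: (addrI (f 0)); rewrite -fD !addr0. Qed.

Lemma hadicN (V W : zmodType) (f : hser V -> hser W) : hadic f ->
  {morph f : x / - x}.
Proof.
move=> fh x; apply: (addrI (f x)); rewrite -(hadicD fh) !subrr.
exact: hadic0.
Qed.

Lemma hadic_id (V : zmodType) : hadic (id : hser V -> hser V).
Proof. by []. Qed.

Lemma hadic_comp (V W Z : zmodType) (f : hser W -> hser Z) (g : hser V -> hser W) :
  hadic f -> hadic g -> hadic (fun x => f (g x)).
Proof. by move=> [fD fs] [gD gs]; split=> [x y|x]; rewrite ?gD ?fD ?gs ?fs. Qed.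

Lemma hser_split (V : zmodType) (x : hser V) :
  x = hconst (x 0%N) + hshift (fun n => x n.+1).
Proof. by apply/funext => -[|n]; rewrite hserD /= ?addr0 ?add0r. Qed.

(** Peel off the constant coefficient: the rest is h times a series, so coefficient n+1 of the image
    is determined by coefficient n of the image of the tail. *)
Lemma hadic_ext (V W : zmodType) (f g : hser V -> hser W) : hadic f -> hadic g ->
  (forall v, f (hconst v) = g (hconst v)) -> forall x, f x = g x.
Proof.
move=> [fD fs] [gD gs] fg x; apply/funext => n; elim: n x => [|n IH] x;
  rewrite (hser_split x) fD gD fs gs fg !hserD //=.
by congr (_ + _); apply: IH.
Qed.

Lemma hconstD (V : zmodType) (v w : V) : hconst (v + w) = hconst v + hconst w.
Proof. by apply/funext => -[|n]; rewrite hserD /= ?addr0. Qed.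
Lemma hconst0 (V : zmodType) : hconst (0 : V) = 0.
Proof. by apply/funext => -[]. Qed.
Lemma hconstN (V : zmodType) (v : V) : hconst (- v) = - hconst v.
Proof. by apply/funext => -[|n]; rewrite hserN /= ?oppr0. Qed.

Lemma hmap_hadic (V W : zmodType) (f : V -> W) : {morph f : x y / x + y} ->
  hadic (hmap f).
Proof.
move=> fD; have f0 : f 0 = 0 by apply: (addrI (f 0)); rewrite -fD !addr0.
split=> [x y|x]; apply/funext => n; first by rewrite hserD -fD.
by case: n.
Qed.

Lemma hmap_const (V W : zmodType) (f : V -> W) v : {morph f : x y / x + y} ->
  hmap f (hconst v) = hconst (f v).
Proof.
move=> fD; have f0 : f 0 = 0 by apply: (addrI (f 0)); rewrite -fD !addr0.
by apply/funext => -[].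
Qed.

Section Cauchy.
Variables (V W Z : zmodType) (b : V -> W -> Z).
Hypothesis bl : forall w, {morph b^~ w : v v' / v + v'}.
Hypothesis br : forall v, {morph b v : w w' / w + w'}.

(** Ring multiplication, scalar multiplication and [hpure] on series are all of this form by
    conversion, so the lemmas below serve the three of them. *)
Definition cauchy (x : hser V) (y : hser W) : hser Z :=
  fun n => \sum_(i < n.+1) b (x i) (y (n - i)%N).

Let b0l w : b 0 w = 0.
Proof. by apply: (addrI (b 0 w)); rewrite -bl !addr0. Qed.
Let b0r v : b v 0 = 0.
Proof. by apply: (addrI (b v 0)); rewrite -br !addr0. Qed.

Lemma cauchy_hadicl y : hadic (cauchy^~ y).
Proof.
split=> [x x'|x]; apply/funext => n.
  by rewrite hserD -big_split; apply: eq_bigr => i _; exact: bl.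
case: n => [|n] /=; rewrite /cauchy big_ord_recl /= b0l add0r; first by rewrite big_ord0.
by apply: eq_bigr => i _; rewrite subSS.
Qed.

Lemma cauchy_hadicr x : hadic (cauchy x).
Proof.
split=> [y y'|y]; apply/funext => n.
  by rewrite hserD -big_split; apply: eq_bigr => i _; exact: br.
case: n => [|n] /=; rewrite /cauchy big_ord_recr /= ?subnn b0r addr0; first by rewrite big_ord0.
by apply: eq_bigr => i _; rewrite subSn // -ltnS.
Qed.

Lemma cauchy_const v w : cauchy (hconst v) (hconst w) = hconst (b v w).
Proof.
apply/funext => -[|n]; rewrite /cauchy big_ord_recl ?big_ord0 ?addr0 //= b0r add0r.
by rewrite big1 // => i _; rewrite b0l.
Qed.
End Cauchy.

Lemma hmul_hadicl (A : nzRingType) (y : hser A) : hadic (fun x => x * y).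
Proof. by apply: (cauchy_hadicl (b := *%R)) => ? ? ?; rewrite mulrDl. Qed.
Lemma hmul_hadicr (A : nzRingType) (x : hser A) : hadic (fun y => x * y).
Proof. by apply: (cauchy_hadicr (b := *%R)) => ? ? ?; rewrite mulrDr. Qed.
Lemma hmul_const (A : nzRingType) (a b : A) : hconst a * hconst b = hconst (a * b).
Proof. by apply: (cauchy_const (b := *%R)) => ? ? ?; rewrite (mulrDl, mulrDr). Qed.

End Hadic.

(** * Semilinear maps between modules of formal power series *)

Section Semilinear.
Context {K : comNzRingType}.
Implicit Types (U V W Z : lmodType K) (theta : K -> K).

(** Only constant scalars appear, so that conjugate-linear maps are covered;
    together with [hadic] this gives linearity over hser K when theta is id. *)
Definition hsemilinear theta V W (f : hser V -> hser W) :=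
  hadic f /\ forall a x, f (hmap ( *:%R a) x) = hmap ( *:%R (theta a)) (f x).

Lemma hsemilinear_hadic theta V W (f : hser V -> hser W) : hsemilinear theta f -> hadic f.
Proof. by case. Qed.

Lemma hsemilinear_id V : hsemilinear id (id : hser V -> hser V).
Proof. by []. Qed.

Lemma hsemilinear_comp t1 t2 U V W (f : hser V -> hser W) (g : hser U -> hser V) :
  hsemilinear t1 f -> hsemilinear t2 g -> hsemilinear (t1 \o t2) (fun x => f (g x)).
Proof. by move=> [fh fZ] [gh gZ]; split=> [|a x]; [exact: hadic_comp|rewrite gZ fZ]. Qed.

Lemma hscale_hadicl V (x : hser V) : hadic (fun s : hser K => s *: x).
Proof. by apply: (cauchy_hadicl (b := *:%R)) => ? ? ?; rewrite scalerDl. Qed.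
Lemma hscale_hadicr V (s : hser K) : hadic (fun x : hser V => s *: x).
Proof. by apply: (cauchy_hadicr (b := *:%R)) => ? ? ?; rewrite scalerDr. Qed.
Lemma hscale_const V (a : K) (x : hser V) : hconst a *: x = hmap ( *:%R a) x.
Proof.
have sD : {morph ( *:%R a : V -> V) : x y / x + y} by move=> ? ?; rewrite scalerDr.
apply: (hadic_ext (f := *:%R (hconst a))) => [||v].
- exact: hscale_hadicr.
- exact: hmap_hadic.
- rewrite hmap_const //.
  by apply: (cauchy_const (b := *:%R)) => ? ? ?; rewrite (scalerDl, scalerDr).
Qed.

Definition hvar : hser K := fun n => (n == 1%N)%:R.
Lemma hscale_var V (x : hser V) : hvar *: x = hshift x.
Proof.
apply/funext => -[|n]; rewrite hserZ big_ord_recl /= scale0r add0r ?big_ord0 //.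
rewrite big_ord_recl /= scale1r subn1 /= big1 ?addr0 // => i _.
by rewrite scale0r.
Qed.

(** Both sides are h-adic in the scalar [s], which reduces the claim to constant scalars. *)
Lemma hsemilinear_linear V W (f : hser V -> hser W) : hsemilinear id f ->
  forall (s : hser K) x y, f (s *: x + y) = s *: f x + f y.
Proof.
move=> [fh fZ] s x y; rewrite (hadicD fh); congr (_ + _).
apply: (hadic_ext (f := fun s => f (s *: x)) (g := fun s => s *: f x)).
- by apply: (hadic_comp (f := f)) => //; exact: hscale_hadicl.
- exact: hscale_hadicl.
- by move=> a; rewrite !hscale_const fZ.
Qed.

Lemma hsemilinearZ V W (f : hser V -> hser W) : hsemilinear id f ->
  forall (s : hser K) x, f (s *: x) = s *: f x.
Proof.
by move=> fZ s x; have := hsemilinear_linear fZ s x 0; rewrite (hadic0 fZ.1) !addr0.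
Qed.

Lemma hmap_hsemilinear theta V W (f : V -> W) : {morph f : x y / x + y} ->
  (forall a, {morph f : x / a *: x >-> theta a *: x}) -> hsemilinear theta (hmap f).
Proof.
move=> fD fZ; split; first exact: hmap_hadic.
by move=> a x; apply/funext => n; apply: fZ.
Qed.

(** The coefficientwise map [hmap theta] fixes the scalar h because [theta] fixes 0 and 1; as h acts
    by the shift, commutation with shifts is a case of semilinearity. *)
Lemma hsemilinear_of_linear theta V W (f : hser V -> hser W) : theta 0 = 0 -> theta 1 = 1 ->
  (forall (s : hser K) x y, f (s *: x + y) = hmap theta s *: f x + f y) ->
  hsemilinear theta f.
Proof.
move=> theta0 theta1 fL.
have one : hmap theta (1 : hser K) = 1 by apply/funext => -[].
have var : hmap theta hvar = hvar by apply/funext => -[|[|n]].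
have const a : hmap theta (hconst a) = hconst (theta a) by apply/funext => -[].
have fD : {morph f : x y / x + y}.
  by move=> x y; have := fL 1 x y; rewrite one !scale1r.
have f0 : f 0 = 0 by apply: (addrI (f 0)); rewrite -fD !addr0.
have fZ s x : f (s *: x) = hmap theta s *: f x by have := fL s x 0; rewrite f0 !addr0.
split; first by split=> // x; rewrite -!hscale_var fZ var.
by move=> a x; rewrite -!hscale_const fZ const.
Qed.

Lemma hpure_hadicl V W (y : hser W) : hadic (fun x : hser V => hpure x y).
Proof. by apply: (cauchy_hadicl (b := @tpure _ _ _)) => ? ? ?; rewrite tpureDl. Qed.
Lemma hpure_hadicr V W (x : hser V) : hadic (fun y : hser W => hpure x y).
Proof. by apply: (cauchy_hadicr (b := @tpure _ _ _)) => ? ? ?; rewrite tpureDr. Qed.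
Lemma hpure_const V W (v : V) (w : W) : hpure (hconst v) (hconst w) = hconst (tpure v w).
Proof.
by apply: (cauchy_const (b := @tpure _ _ _)) => ? ? ?; rewrite (tpureDl, tpureDr).
Qed.
Lemma hpureZl V W a (x : hser V) (y : hser W) :
  hmap ( *:%R a) (hpure x y) = hpure (hmap ( *:%R a) x) y.
Proof.
by apply/funext => n; rewrite /hmap scaler_sumr; apply: eq_bigr => i _; rewrite tpureZl.
Qed.
Lemma hpureZr V W a (x : hser V) (y : hser W) :
  hmap ( *:%R a) (hpure x y) = hpure x (hmap ( *:%R a) y).
Proof.
by apply/funext => n; rewrite /hmap scaler_sumr; apply: eq_bigr => i _; rewrite tpureZr.
Qed.
(* Composition rules used by [hadic_tac]; [hadic_comp] itself cannot be unified
   when the variable occurs in a non-final argument. *)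
Lemma hpure_hadicl_comp (X : zmodType) V W (y : hser W) (g : hser X -> hser V) :
  hadic g -> hadic (fun x => hpure (g x) y).
Proof. by move=> gh; apply: (hadic_comp (f := fun x => hpure x y)); first exact: hpure_hadicl. Qed.
Lemma hscale_hadicl_comp (X : zmodType) V (y : hser V) (g : hser X -> hser K) :
  hadic g -> hadic (fun x => g x *: y).
Proof. by move=> gh; apply: (hadic_comp (f := fun s => s *: y)); first exact: hscale_hadicl. Qed.
Lemma hmul_hadicl_comp (X : zmodType) (A : nzRingType) (y : hser A) (g : hser X -> hser A) :
  hadic g -> hadic (fun x => g x * y).
Proof. by move=> gh; apply: (hadic_comp (f := fun s => s * y)); first exact: hmul_hadicl. Qed.

Lemma hmapZ_hadic V (a : K) : hadic (hmap ( *:%R a : V -> V)).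
Proof. by apply: hmap_hadic => x y; rewrite scalerDr. Qed.

End Semilinear.

Create HintDb hadic.
Ltac hadic_tac :=
  match goal with
  | |- hadic (fun s => s) => exact: hadic_id
  | |- hadic (fun s => ?f s) => hadic_atom
  | |- hadic (fun s => hpure s ?y) => exact: hpure_hadicl
  | |- hadic (fun s => hpure (@?g s) ?y) =>
      apply (hpure_hadicl_comp y (g := g)); hadic_tac
  | |- hadic (fun s => s *: ?y) => exact: hscale_hadicl
  | |- hadic (fun s => (@?g s) *: ?y) =>
      apply (hscale_hadicl_comp y (g := g)); hadic_tac
  | |- hadic (fun s => s * ?y) => exact: hmul_hadicl
  | |- hadic (fun s => (@?g s) * ?y) =>
      apply (hmul_hadicl_comp y (g := g)); hadic_tac
  | |- hadic (fun s => ?f (@?g s)) =>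
      apply (hadic_comp (f := f) (g := g)); [hadic_atom|hadic_tac]
  | |- _ => hadic_atom
  end
with hadic_atom := first
  [ exact: hpure_hadicr | exact: hscale_hadicr | exact: hmul_hadicr
  | by eauto with hadic ].

(** * Maps on completed tensor products *)

Section Tensors.
Context {K : comNzRingType}.
Implicit Types (U V W Z : lmodType K) (theta : K -> K).

Lemma hpure_scalel V W (s : hser K) (x : hser V) (y : hser W) : hpure (s *: x) y = s *: hpure x y.
Proof.
apply: (hadic_ext (f := fun s => hpure (s *: x) y) (g := fun s => s *: hpure x y)) => [||a].
- by hadic_tac.
- by hadic_tac.
- by rewrite !hscale_const hpureZl.
Qed.
Lemma hpure_scaler V W (s : hser K) (x : hser V) (y : hser W) : hpure x (s *: y) = s *: hpure x y.
Proof.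
apply: (hadic_ext (f := fun s => hpure x (s *: y)) (g := fun s => s *: hpure x y)) => [||a].
- by hadic_tac.
- by hadic_tac.
- by rewrite !hscale_const hpureZr.
Qed.

(** The working extensionality principle for completed tensor products: [hadic_ext] leaves constant
    series, and a constant tensor is a signed sum of pure ones. *)
Lemma tensor_hadic_ext V W (Z : zmodType) (f g : hser (tensor V W) -> hser Z) :
  hadic f -> hadic g -> (forall x y, f (hpure x y) = g (hpure x y)) ->
  forall t, f t = g t.
Proof.
move=> fh gh fg; apply: hadic_ext => //.
elim/tensor_ind=> [|x IH|x y IHx IHy|v w].
- by rewrite hconst0 !hadic0.
- by rewrite hconstN !hadicN ?IH.
- by rewrite hconstD !hadicD ?IHx ?IHy.
- by rewrite -hpure_const.
Qed.

Lemma hadic_ext2 (V W Z : zmodType) (f g : hser V -> hser W -> hser Z) :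
  (forall y, hadic (fun x => f x y)) -> (forall x, hadic (f x)) ->
  (forall y, hadic (fun x => g x y)) -> (forall x, hadic (g x)) ->
  (forall v w, f (hconst v) (hconst w) = g (hconst v) (hconst w)) ->
  forall x y, f x y = g x y.
Proof.
move=> fl fr gl gr fg x y.
apply: (hadic_ext (f := fun x => f x y) (g := fun x => g x y)) => // v.
exact: hadic_ext.
Qed.

(** Balancedness concerns constant scalars only and no linearity is imposed, so that maps built from
    two conjugate-linear ones are covered. *)
Definition bihadic V W (Z : zmodType) (b : hser V -> hser W -> hser Z) :=
  [/\ forall y, hadic (fun x => b x y), forall x, hadic (b x)
    & forall a x y, b (hmap ( *:%R a) x) y = b x (hmap ( *:%R a) y)].

Section Lift.
Variables (V W : lmodType K) (Z : zmodType) (b : hser V -> hser W -> hser Z).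
Hypothesis bP : bihadic b.

Let bal : balanced (fun v w => b (hconst v) (hconst w)).
Proof.
have sD a (X : lmodType K) : {morph ( *:%R a : X -> X) : x y / x + y}.
  by move=> ? ?; rewrite scalerDr.
case: bP => bl br bZ; split=> [w v v'|v w w'|a v w].
- by rewrite hconstD (hadicD (bl _)).
- by rewrite hconstD (hadicD (br _)).
- by rewrite -!(hmap_const _ (sD a _)) bZ.
Qed.

Lemma hlift_hadic : hadic (hlift (fun v w => b (hconst v) (hconst w))).
Proof.
split=> [x y|x]; apply/funext => n.
  by rewrite hserD -big_split; apply: eq_bigr => i _; rewrite (tliftD bal).
case: n => [|n] /=; rewrite /hlift big_ord_recl /= (tlift0 bal) hser0 add0r.
  by rewrite big_ord0.
by apply: eq_bigr => i _; rewrite subSS.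
Qed.

(** Universal property of the completed tensor product. Both sides are h-adic in each argument, and
    on constants only the term of index 0 survives in the sum defining [hlift]. *)
Lemma hlift_pure x y : hlift (fun v w => b (hconst v) (hconst w)) (hpure x y) = b x y.
Proof.
case: bP => bl br _; move: x y; apply: hadic_ext2 => //.
- by move=> y; apply: (hadic_comp hlift_hadic); exact: hpure_hadicl.
- by move=> x; apply: (hadic_comp hlift_hadic); exact: hpure_hadicr.
move=> v w; rewrite hpure_const; apply/funext => n.
rewrite /hlift big_ord_recl /= subn0 (tlift_pure bal) big1 ?addr0 // => i _.
by rewrite (tlift0 bal).
Qed.
End Lift.

Section Tens.
Variables (V W V' W' : lmodType K) (theta : K -> K).
Variables (f : hser V -> hser V') (g : hser W -> hser W').
Hypothesis (fP : hsemilinear theta f) (gP : hsemilinear theta g).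
Local Hint Resolve hsemilinear_hadic hmapZ_hadic : hadic.

Let htens_bihadic : bihadic (fun x y => hpure (f x) (g y)).
Proof.
by split=> [y|x|a x y]; [hadic_tac|hadic_tac|rewrite fP.2 gP.2 -hpureZl hpureZr].
Qed.

Lemma htens_hadic : hadic (htens f g).
Proof. exact: hlift_hadic htens_bihadic. Qed.

Lemma htens_pure x y : htens f g (hpure x y) = hpure (f x) (g y).
Proof. exact: (hlift_pure htens_bihadic). Qed.

Local Hint Resolve htens_hadic : hadic.
Lemma htens_hsemilinear : hsemilinear theta (htens f g).
Proof.
split=> [|a]; first exact: htens_hadic.
apply: tensor_hadic_ext; [by hadic_tac|by hadic_tac|] => x y.
by rewrite hpureZl !htens_pure hpureZl fP.2.
Qed.
End Tens.

End Tensors.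

#[export] Hint Resolve hsemilinear_hadic hmapZ_hadic htens_hadic : hadic.

(** * Algebras of formal power series *)

Section HadicAlgebra.
Lemma hadic_add (V W : zmodType) (f g : hser V -> hser W) : hadic f -> hadic g ->
  hadic (fun x => f x + g x).
Proof.
move=> [fD fs] [gD gs]; split=> [x y|x]; first by rewrite fD gD addrACA.
by rewrite fs gs; apply/funext => -[|n]; rewrite hserD /= ?addr0.
Qed.
Lemma hshift_hadic (V : zmodType) : hadic (@hshift V).
Proof. by split=> // x y; apply/funext => -[|n]; rewrite hserD /= ?addr0. Qed.

Lemma hmapM (A B : nzRingType) (f : A -> B) : {morph f : x y / x + y} ->
  {morph f : x y / x * y} -> {morph hmap f : x y / x * y}.
Proof.
move=> fD fM x y; have f0 : f 0 = 0 by apply: (addrI (f 0)); rewrite -fD !addr0.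
apply/funext => n; rewrite /hmap !hserM (big_morph f fD f0).
by apply: eq_bigr => i _; rewrite fM.
Qed.

Lemma hmapM_anti (A B : nzRingType) (f : A -> B) : {morph f : x y / x + y} ->
  {morph f : x y / x * y >-> y * x} -> {morph hmap f : x y / x * y >-> y * x}.
Proof.
move=> fD fM.
have fh := hmap_hadic fD.
apply: (hadic_ext2 (f := fun x y => hmap f (x * y)) (g := fun x y => hmap f y * hmap f x)).
- by move=> y; hadic_tac.
- by move=> x; hadic_tac.
- by move=> y; hadic_tac.
- by move=> x; hadic_tac.
- by move=> v w; rewrite hmul_const !hmap_const // hmul_const fM.
Qed.

Lemma hmap1 (A B : nzRingType) (f : A -> B) : {morph f : x y / x + y} -> f 1 = 1 ->
  hmap f 1 = 1.
Proof. by move=> fD f1; rewrite -[1]/(hconst 1) hmap_const // f1. Qed.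

Lemma inverse_inverses (B : nzRingType) (x : B) : (exists y, inverses x y) ->
  inverses x (inverse x).
Proof. by move=> ex; rewrite /inverse; case: pselect => // e; case: (cid e). Qed.

(** Once the lower coefficients of [s] vanish, the n-th coefficient of the product is [s n *: x 0].
    This allows a series with nonzero constant term to be cancelled. *)
Lemma hscale_eq0 (K : fieldType) (V : lmodType K) (s : hser K) (x : hser V) :
  x 0%N != 0 -> s *: x = 0 -> s = 0.
Proof.
move=> x0 sx; apply/funext => n; elim/ltn_ind: n => n IH.
have /(congr1 (@^~ n)) := sx; rewrite hserZ big_ord_recr /= subnn big1 => [|i _].
  by move/eqP; rewrite add0r scaler_eq0 (negPf x0) orbF => /eqP.
by rewrite IH // scale0r.
Qed.

End HadicAlgebra.

#[export] Hint Resolve hshift_hadic : hadic.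

(** * Componentwise actions on completed tensor squares *)

Section Action.
Context {K : comNzRingType} (A V : lmodType K) (act : hser A -> hser V -> hser V).
Hypothesis actl : forall x, hsemilinear id (fun a => act a x).
Hypothesis actr : forall a, hsemilinear id (act a).

Let hpureDl (U W : lmodType K) (x x' : hser U) (y : hser W) :
  hpure (x + x') y = hpure x y + hpure x' y.
Proof. exact: (proj1 (hpure_hadicl _ y)). Qed.
Let hpureDr (U W : lmodType K) (x : hser U) (y y' : hser W) :
  hpure x (y + y') = hpure x y + hpure x y'.
Proof. exact: (proj1 (hpure_hadicr _ x)). Qed.
Let hpure_shiftl (U W : lmodType K) (x : hser U) (y : hser W) :
  hpure (hshift x) y = hshift (hpure x y).
Proof. exact: (proj2 (hpure_hadicl _ y)). Qed.
Let hpure_shiftr (U W : lmodType K) (x : hser U) (y : hser W) :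
  hpure x (hshift y) = hshift (hpure x y).
Proof. exact: (proj2 (hpure_hadicr _ x)). Qed.

(** This is what the lift defining [hact2] requires. For fixed [a] and [b] every identity to be
    shown is h-adic in [t], hence can be checked on pure [t]. *)
Lemma htens_act_bihadic t : bihadic (fun a b => htens (act a) (act b) t).
Proof.
have hl x := hsemilinear_hadic (actl x).
have hr a := hsemilinear_hadic (actr a).
have hh a b := htens_hadic (actr a) (actr b).
have aD x y z : act (x + y) z = act x z + act y z by exact: (hadicD (hl z)).
have as_ x z : act (hshift x) z = hshift (act x z) by exact: (proj2 (hl z)).
split=> [b|a|c a b].
- split=> [a a'|a]; move: t; apply: tensor_hadic_ext => //.
  + by apply: hadic_add.
  + by move=> x y; rewrite !(htens_pure (actr _) (actr _)) aD hpureDl.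
  + by apply: (hadic_comp (@hshift_hadic _)).
  + by move=> x y; rewrite !(htens_pure (actr _) (actr _)) as_ hpure_shiftl.
- split=> [b b'|b]; move: t; apply: tensor_hadic_ext => //.
  + by apply: hadic_add.
  + by move=> x y; rewrite !(htens_pure (actr _) (actr _)) aD hpureDr.
  + by apply: (hadic_comp (@hshift_hadic _)).
  + by move=> x y; rewrite !(htens_pure (actr _) (actr _)) as_ hpure_shiftr.
- move: t; apply: tensor_hadic_ext => // x y.
  by rewrite !(htens_pure (actr _) (actr _)) !(proj2 (actl _)) -hpureZl hpureZr.
Qed.

Lemma hact2_hadicl t : hadic (fun F => hact2 act F t).
Proof. exact: hlift_hadic (htens_act_bihadic t). Qed.

Lemma hact2_pure a b t : hact2 act (hpure a b) t = htens (act a) (act b) t.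
Proof. exact: (hlift_pure (htens_act_bihadic t)). Qed.

Lemma hact2_pure2 a b x y :
  hact2 act (hpure a b) (hpure x y) = hpure (act a x) (act b y).
Proof. by rewrite hact2_pure (htens_pure (actr _) (actr _)). Qed.

Lemma hact2_hsemilinear F : hsemilinear id (hact2 act F).
Proof.
have H a b := htens_hsemilinear (actr a) (actr b).
have hl := hact2_hadicl.
split; first split.
- move=> s t; move: F; apply: tensor_hadic_ext => //; first exact: hadic_add.
  by move=> a b; rewrite !hact2_pure (hadicD (hsemilinear_hadic (H a b))).
- move=> t; move: F; apply: tensor_hadic_ext => //.
    exact: (hadic_comp (@hshift_hadic _)).
  by move=> a b; rewrite !hact2_pure (proj2 (hsemilinear_hadic (H a b))).
- move=> c t; move: F; apply: tensor_hadic_ext => //.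
    by apply: (hadic_comp (g := fun F => hact2 act F t)); first exact: hmapZ_hadic.
  by move=> a b; rewrite !hact2_pure (proj2 (H a b)).
Qed.

End Action.

Section TensorAlgebra.
Context {K : comNzRingType} {X Y : Type} (P : presentation K X) (Q : presentation K Y).
Local Notation A := (presalg P).
Local Notation B := (presalg Q).

Lemma hpureM (a c : hser A) (b d : hser B) :
  hpure a b * hpure c d = hpure (a * c) (b * d).
Proof.
move: a c; apply: hadic_ext2 => [c|a|c|a|a c]; try by hadic_tac.
move: b d; apply: hadic_ext2 => [c'|a'|c'|a'|b d]; try by hadic_tac.
by rewrite !hpure_const !hmul_const tpureM hpure_const.
Qed.

Lemma hpure1 : hpure (1 : hser A) (1 : hser B) = 1.
Proof. exact: hpure_const. Qed.
End TensorAlgebra.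

Section ActionTensor.
Context {K : comNzRingType} {X : Type} (P : presentation K X) (V : lmodType K).
Local Notation A := (presalg P).
Variable act : hser A -> hser V -> hser V.
Hypothesis actl : forall x, hsemilinear id (fun a => act a x).
Hypothesis actr : forall a, hsemilinear id (act a).
Hypothesis actM : forall a b x, act (a * b) x = act a (act b x).

Lemma hact2M (F G : hser (tensor A A)) t :
  hact2 act (F * G) t = hact2 act F (hact2 act G t).
Proof.
have hl := hact2_hadicl actl actr.
have hr F' := hsemilinear_hadic (hact2_hsemilinear actl actr F').
move: F; apply: tensor_hadic_ext => [||a b]; try by hadic_tac.
  by apply: (hadic_comp (hl t)); exact: hmul_hadicl.
move: G; apply: tensor_hadic_ext => [||c d].
- by apply: (hadic_comp (hl t)); exact: hmul_hadicr.
- by apply: (hadic_comp (hr _)).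
move: t; apply: tensor_hadic_ext => [||x y] //.
  by apply: (hadic_comp (hr _)).
by rewrite hpureM !hact2_pure2 // !actM.
Qed.

End ActionTensor.

(** * Enveloping algebras *)

Section PresentedAlgebra.
Context {K : comNzRingType} {X : Type} (P : presentation K X).
Local Notation U := (presalg P).

(** Zero and opposites need no cases of their own, being multiples by the scalars 0 and -1. *)
Lemma presalg_ind (Q : U -> Prop) :
  (forall x, Q (agen P x)) -> Q 1 -> (forall u v, Q u -> Q v -> Q (u + v)) ->
  (forall a u, Q u -> Q (a *: u)) -> (forall u v, Q u -> Q v -> Q (u * v)) ->
  forall u, Q u.
Proof.
move=> Qg Q1 QD QZ QM; have Q0 : Q 0 by rewrite -(scale0r 1); apply: QZ.
elim/quotW; elim=> [x||| t Qt|t Qt u Qu|a t Qt|t Qt u Qu].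
- exact: Qg.
- exact: Q0.
- exact: Q1.
- by rewrite -aopp_pi -[aopp _]/(- _) -scaleN1r; apply: QZ.
- by rewrite -apiD; apply: QD.
- by rewrite -apiZ; apply: QZ.
- by rewrite -amul_pi; apply: QM.
Qed.

Section Ahom.
Variables (A : algType K) (f : X -> A).
Hypothesis fP : forall t u, P t u -> aeval *%R f t = aeval *%R f u.
Let E t : ahom f (\pi_(presalg P) t) = aeval *%R f t := ahom_pi t fP.

Lemma ahom1 : ahom f (1 : U) = 1. Proof. exact: (E AOne). Qed.
Lemma ahomD : {morph (ahom f : U -> A) : x y / x + y}.
Proof. by elim/quotW=> t; elim/quotW=> u; rewrite apiD !E. Qed.
Lemma ahomZ a : {morph (ahom f : U -> A) : x / a *: x}.
Proof. by elim/quotW=> t; rewrite apiZ !E. Qed.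
Lemma ahomM : {morph (ahom f : U -> A) : x y / x * y}.
Proof.
by elim/quotW=> t; elim/quotW=> u; rewrite -[_ * _]/(amul _ _) amul_pi !E.
Qed.
End Ahom.

Section Aantihom.
Variables (A : algType K) (f : X -> A).
Hypothesis fP : forall t u, P t u ->
  aeval (fun x y => y * x) f t = aeval (fun x y => y * x) f u.
Let E t : aantihom f (\pi_(presalg P) t) = aeval (fun x y => y * x) f t := aantihom_pi t fP.

Lemma aantihom1 : aantihom f (1 : U) = 1. Proof. exact: (E AOne). Qed.
Lemma aantihomD : {morph (aantihom f : U -> A) : x y / x + y}.
Proof. by elim/quotW=> t; elim/quotW=> u; rewrite apiD !E. Qed.
Lemma aantihomZ a : {morph (aantihom f : U -> A) : x / a *: x}.
Proof. by elim/quotW=> t; rewrite apiZ !E. Qed.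
Lemma aantihomM : {morph (aantihom f : U -> A) : x y / x * y >-> y * x}.
Proof.
by elim/quotW=> t; elim/quotW=> u; rewrite -[_ * _]/(amul _ _) amul_pi !E.
Qed.
End Aantihom.

End PresentedAlgebra.

(** * Hopf structure, filtration and primitive elements of U(g) *)

Section EnvelopingHopf.
Context {K : fieldType} (g : lieAlgebra K).
Local Notation U := (enveloping g).

(** For the bracket relation, the mixed terms x (x) y and y (x) x cancel in the commutator of two
    primitive elements. *)
Lemma udelta_rel (t u : aterm K g) : lie_rel t u ->
  aeval *%R (fun x => tpure (uincl x) 1 + tpure 1 (uincl x) : tensor U U) t =
  aeval *%R (fun x => tpure (uincl x) 1 + tpure 1 (uincl x)) u.
Proof.
case=> [x y|a x|x y] /=.
- by rewrite uinclD tpureDl tpureDr addrACA.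
- by rewrite uinclZ scalerDr tpureZl tpureZr.
rewrite uincl_lie tpureDl tpureDr tpureNl tpureNr.
rewrite !mulrDl !mulrDr !tpureM !mul1r !mulr1.
set p := tpure (uincl x) (uincl y); set q := tpure (uincl y) (uincl x).
rewrite [X in _ = X - _]addrACA opprD [RHS]addrACA; congr (_ + _).
  by rewrite opprD addrACA subrr addr0.
by rewrite opprD addrACA subrr add0r.
Qed.

Lemma uS_rel (t u : aterm K g) : lie_rel t u ->
  aeval (fun x y : U => y * x) (fun x => - uincl x) t =
  aeval (fun x y : U => y * x) (fun x => - uincl x) u.
Proof.
case=> [x y|a x|x y] /=.
- by rewrite uinclD opprD.
- by rewrite uinclZ scalerN.
- by rewrite uincl_lie !mulrNN opprB.
Qed.

Lemma udeltaD : {morph @udelta K g : x y / x + y}.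
Proof. exact: (ahomD (P := lie_presentation g) udelta_rel). Qed.
Lemma udeltaZ a : {morph @udelta K g : x / a *: x}.
Proof. exact: (ahomZ (P := lie_presentation g) udelta_rel). Qed.
Lemma udeltaM : {morph @udelta K g : x y / x * y}.
Proof. exact: (ahomM (P := lie_presentation g) udelta_rel). Qed.
Lemma udelta1 : udelta (1 : U) = 1.
Proof. exact: (ahom1 (P := lie_presentation g) udelta_rel). Qed.

Lemma uepsD : {morph @ueps K g : x y / x + y}.
Proof. exact: (ahomD (A := K^o) (@prel_aug _ _ (lie_presentation g))). Qed.
Lemma uepsZ a : {morph @ueps K g : x / a *: x >-> a * x}.
Proof. exact: (ahomZ (A := K^o) (@prel_aug _ _ (lie_presentation g))). Qed.
Lemma uepsM : {morph @ueps K g : x y / x * y}.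
Proof. exact: (ahomM (A := K^o) (@prel_aug _ _ (lie_presentation g))). Qed.
Lemma ueps1 : ueps (1 : U) = 1.
Proof. exact: (ahom1 (A := K^o) (@prel_aug _ _ (lie_presentation g))). Qed.

Lemma uSD : {morph @uS K g : x y / x + y}.
Proof. exact: (aantihomD (P := lie_presentation g) uS_rel). Qed.
Lemma uSZ a : {morph @uS K g : x / a *: x}.
Proof. exact: (aantihomZ (P := lie_presentation g) uS_rel). Qed.
Lemma uSM : {morph @uS K g : x y / x * y >-> y * x}.
Proof. exact: (aantihomM (P := lie_presentation g) uS_rel). Qed.
Lemma uS1 : uS (1 : U) = 1.
Proof. exact: (aantihom1 (P := lie_presentation g) uS_rel). Qed.

Lemma uS_involutive : involutive (@uS K g).
Proof.
elim/(presalg_ind (P := lie_presentation g))=> [x||u v IHu IHv|a u IH|u v IHu IHv].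
- by rewrite -[agen _ x]/(uincl x) uS_uincl -scaleN1r uSZ uS_uincl scaleN1r opprK.
- by rewrite !uS1.
- by rewrite !uSD IHu IHv.
- by rewrite !uSZ IH.
- by rewrite !uSM IHu IHv.
Qed.

(** The standard filtration by word length. Words grow by one letter on the left, so inductions
    handle one letter at a time; the unit is put in every level, which makes the filtration
    increasing. *)
Inductive fil : nat -> U -> Prop :=
| fil_one n : fil n 1
| fil_add n u v : fil n u -> fil n v -> fil n (u + v)
| fil_scale n a u : fil n u -> fil n (a *: u)
| fil_mulg n x u : fil n u -> fil n.+1 (uincl x * u).

Lemma fil0 n : fil n 0. Proof. by rewrite -(scale0r 1); apply/fil_scale/fil_one. Qed.
Lemma fil_opp n u : fil n u -> fil n (- u).
Proof. by move=> fu; rewrite -scaleN1r; apply: fil_scale. Qed.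
Lemma fil_sub n u v : fil n u -> fil n v -> fil n (u - v).
Proof. by move=> fu fv; apply: fil_add => //; apply: fil_opp. Qed.

Lemma fil_weaken m n u : fil m u -> (m <= n)%N -> fil n u.
Proof.
move=> fu; elim: fu n => {m u} [m|m u v _ IHu _ IHv|m a u _ IH|m x u _ IH] n mn.
- exact: fil_one.
- by apply: fil_add; [apply: IHu|apply: IHv].
- by apply: fil_scale; apply: IH.
- by case: n mn => // n mn; apply: fil_mulg; apply: IH.
Qed.

Lemma fil_mul m n u v : fil m u -> fil n v -> fil (m + n) (u * v).
Proof.
move=> fu fv; elim: fu => {m u} [m|m u w _ IHu _ IHv|m a u _ IH|m x u _ IH].
- by rewrite mul1r; apply: fil_weaken fv _; apply: leq_addl.
- by rewrite mulrDl; apply: fil_add.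
- by rewrite -scalerAl; apply: fil_scale.
- by rewrite -mulrA addSn; apply: fil_mulg.
Qed.

Lemma fil_uincl x : fil 1 (uincl x).
Proof. by rewrite -[uincl x]mulr1; apply/fil_mulg/fil_one. Qed.

Lemma fil_exhaustive u : exists n, fil n u.
Proof.
elim/(presalg_ind (P := lie_presentation g)): u =>
  [x||u v [m fu] [n fv]|a u [n fu]|u v [m fu] [n fv]].
- by exists 1%N; apply: fil_uincl.
- by exists 0%N; apply: fil_one.
- exists (m + n)%N; apply: fil_add.
    by apply: fil_weaken fu _; apply: leq_addr.
  by apply: fil_weaken fv _; apply: leq_addl.
- by exists n; apply: fil_scale.
- by exists (m + n)%N; apply: fil_mul.
Qed.

(** Bracketing with [x] is a derivation that replaces one letter of a word by a Lie bracket, which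
    is again a single letter. *)
Lemma fil_commutator n u x : fil n u -> fil n (u * uincl x - uincl x * u).
Proof.
elim=> {n u} [n|n u v _ IHu _ IHv|n a u _ IH|n y u fu IH].
- by rewrite mul1r mulr1 subrr; apply: fil0.
- by rewrite mulrDl mulrDr opprD addrACA; apply: fil_add.
- by rewrite -scalerAl -scalerAr -scalerBr; apply: fil_scale.
rewrite (_ : _ - _ = uincl y * (u * uincl x - uincl x * u) + uincl (lie y x) * u).
  by apply: fil_add; apply: fil_mulg.
by rewrite uincl_lie mulrBr mulrBl !mulrA addrA subrK.
Qed.

(** The filtration of the tensor square by total degree. *)
Inductive tfil : nat -> tensor U U -> Prop :=
| tfil_zero n : tfil n 0
| tfil_add n s t : tfil n s -> tfil n t -> tfil n (s + t)
| tfil_pure i j n u v : fil i u -> fil j v -> (i + j <= n)%N -> tfil n (tpure u v).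

Lemma tfil_scale n a t : tfil n t -> tfil n (a *: t).
Proof.
elim=> {n t} [n|n s t _ IHs _ IHt|i j n u v fu fv ij].
- by rewrite scaler0; apply: tfil_zero.
- by rewrite scalerDr; apply: tfil_add.
- by rewrite tpureZl; apply: tfil_pure (fil_scale _ fu) fv ij.
Qed.

(** Each letter x contributes a factor x (x) 1 + 1 (x) x, which lengthens one of the two legs by
    one. *)
Lemma udelta_fil n u : fil n u -> tfil n (udelta u).
Proof.
elim=> {n u} [n|n u v _ IHu _ IHv|n a u _ IH|n x u _ IH].
- by rewrite udelta1; apply: tfil_pure (fil_one 0) (fil_one 0) _.
- by rewrite udeltaD; apply: tfil_add.
- by rewrite udeltaZ; apply: tfil_scale.
rewrite udeltaM udelta_uincl.
elim: IH => {n} [n|n s t _ IHs _ IHt|i j n v w fv fw ij].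
- by rewrite mulr0; apply: tfil_zero.
- by rewrite mulrDr; apply: tfil_add.
rewrite mulrDl !tpureM !mul1r; apply: tfil_add.
  by apply: tfil_pure (fil_mulg x fv) fw _.
by apply: tfil_pure fv (fil_mulg x fw) _; rewrite addnS.
Qed.

Definition umul : tensor U U -> U := tlift *%R.

Lemma umul_balanced : balanced ( *%R : U -> U -> U).
Proof.
by split=> [w v v'|v w w'|a v w]; rewrite ?mulrDl ?mulrDr // -scalerAl scalerAr.
Qed.

Lemma umul_pure u v : umul (tpure u v) = u * v.
Proof. exact: (tlift_pure umul_balanced). Qed.
Lemma umulD : {morph umul : s t / s + t}.
Proof. exact: (tliftD umul_balanced). Qed.
Lemma umulN : {morph umul : s / - s}.
Proof. exact: (tliftN umul_balanced). Qed.
Lemma umul0 : umul 0 = 0.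
Proof. exact: (tlift0 umul_balanced). Qed.

(** Acts as 2 ^ n on the n-th graded piece of the filtration. *)
Definition adams u := umul (udelta u).

Lemma adamsD : {morph adams : u v / u + v}.
Proof. by move=> u v; rewrite /adams udeltaD umulD. Qed.
Lemma adamsZ a : {morph adams : u / a *: u}.
Proof.
move=> u; rewrite /adams udeltaZ.
elim/tensor_ind: (udelta u) => [|s IH|s t IHs IHt|v w].
- by rewrite !(scaler0, umul0).
- by rewrite scalerN !umulN IH scalerN.
- by rewrite scalerDr !umulD IHs IHt scalerDr.
- by rewrite tpureZl !umul_pure scalerAl.
Qed.

Lemma adams_one : adams 1 = 1.
Proof. by rewrite /adams udelta1 umul_pure mulr1. Qed.

(** A term v (x) w of [udelta u] contributes x v w + v x w = 2 x v w + [v, x] w, and the commutator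
    does not raise the degree. *)
Lemma adams_mulg n x u : fil n u ->
  fil n (adams (uincl x * u) - 2%:R *: (uincl x * adams u)).
Proof.
move=> /udelta_fil; rewrite /adams udeltaM udelta_uincl.
elim=> {n u} [n|n s t _ IHs _ IHt|i j n u v fu fv ij].
- by rewrite mulr0 umul0 mulr0 scaler0 subr0; apply: fil0.
- by rewrite mulrDr !umulD mulrDr scalerDr opprD addrACA; apply: fil_add.
rewrite mulrDl !tpureM !mul1r umulD !umul_pure scaler_nat mulr2n.
rewrite -!mulrA opprD addrACA subrr add0r !mulrA -mulrBl.
by apply: fil_weaken ij; apply: fil_mul => //; apply: fil_commutator.
Qed.

Lemma adams_fil0 u : fil 0 u -> exists a, u = a *: 1.
Proof.
move: {-1}0%N (erefl 0%N) => n n0 fu; elim: fu n0 => {n u}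
  [n|n u v _ IHu _ IHv|n a u _ IH|//] n0.
- by exists 1; rewrite scale1r.
- by have [a ->] := IHu n0; have [b ->] := IHv n0; exists (a + b); rewrite scalerDl.
- by have [b ->] := IH n0; exists (a * b); rewrite scalerA.
Qed.

(** By [adams_mulg] each further letter of a word doubles the eigenvalue modulo lower degree. *)
Lemma adams_fil n u : fil n.+1 u -> fil n (adams u - (2 ^ n.+1)%:R *: u).
Proof.
move: {-1}n.+1 (erefl n.+1) => m mn fu.
elim: fu n mn => {m u} [m|m u v _ IHu _ IHv|m a u _ IH|m x u fu IH] n mn.
- by rewrite adams_one; apply: fil_sub; [|apply: fil_scale]; apply: fil_one.
- by rewrite adamsD scalerDr opprD addrACA; apply: fil_add; [apply: IHu|apply: IHv].
- rewrite adamsZ scalerA [_ * a]mulrC -scalerA -scalerBr.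
  by apply: fil_scale; apply: IH.
case: mn => ->.
(* Insert 2 x [adams u]: the first difference is bounded by [adams_mulg], the second is 2 x times
   the error term for [u]. *)
rewrite -(subrK (2%:R *: (uincl x * adams u)) (adams _)) -addrA.
apply: fil_add; first by apply: adams_mulg.
rewrite expnS natrM -scalerA -scalerBr scalerAr -mulrBr; apply: fil_scale.
(* The induction hypothesis speaks of positive levels only; at level 0 [u] is a scalar, which
   [adams] fixes, so the error is zero. *)
case: m fu IH => [|m] fu IH; last by apply: fil_mulg; apply: IH.
have [a ->] := adams_fil0 fu.
by rewrite adamsZ adams_one expn0 scale1r subrr mulr0; apply: fil0.
Qed.

Lemma fil1_decomp u : fil 1 u -> exists a x, u = a *: 1 + uincl x.
Proof.
move: {-1}1%N (erefl 1%N) => n n1 fu; elim: fu n1 => {n u}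
  [n|n u v _ IHu _ IHv|n a u _ IH|n x u fu _] n1.
- by exists 1, 0; rewrite scale1r -(scale0r 0) uinclZ scale0r addr0.
- have [a [x ->]] := IHu n1; have [b [y ->]] := IHv n1.
  by exists (a + b), (x + y); rewrite scalerDl uinclD addrACA.
- have [b [y ->]] := IH n1; exists (a * b), (a *: y).
  by rewrite scalerDr scalerA uinclZ.
- case: n1 fu => <- /adams_fil0 [a ->]; exists 0, (a *: x).
  by rewrite scale0r add0r uinclZ -scalerAr mulr1.
Qed.

Definition primitive (u : U) := udelta u = tpure u 1 + tpure 1 u.

Lemma adams_uincl x : adams (uincl x) = 2%:R *: uincl x.
Proof.
by rewrite /adams udelta_uincl umulD !umul_pure mulr1 mul1r scaler_nat mulr2n.
Qed.

(** A primitive element satisfies [adams u = 2 u]. In a level above 1 this disagrees with the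
    leading eigenvalue, which forces [u] down to level 1. *)
Lemma primitive_uincl (u : U) : [pchar K] =i pred0 -> primitive u ->
  exists x, u = uincl x.
Proof.
move=> char0 pu.
have au : adams u = 2%:R *: u.
  by rewrite /adams pu umulD !umul_pure mulr1 mul1r scaler_nat mulr2n.
have [n fu] := fil_exhaustive u.
have f1u : fil 1 u.
  case: n fu => [|n]; first by move/fil_weaken; apply.
  elim: n => // n IH fu; apply: IH.
  (* The element (2 - 2^(n+2)) u lies one level lower, and this factor is invertible in
     characteristic 0. The descent stops at level 1, where the factor would be 2 - 2. *)
  have := adams_fil fu; rewrite au -scalerBl => /(fil_scale (2%:R - (2 ^ n.+2)%:R)^-1).
  rewrite scalerA mulVf ?scale1r // subr_eq0 eq_sym -subr_eq0 -natrB; last first.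
    by rewrite -{1}(expn1 2) leq_exp2l.
  by rewrite ((pcharf0P _).1 char0) subn_eq0 -ltnNge -{1}(expn1 2) ltn_exp2l.
have [a [x ux]] := fil1_decomp f1u.
(* Since [adams] fixes 1 and doubles elements of g, comparing scalar parts gives a = 2a, hence a =
   0. *)
exists x; move: au; rewrite ux adamsD adamsZ adams_one adams_uincl scalerDr.
move/addIr => /eqP; rewrite scaler_nat mulr2n -subr_eq0 opprD addrA subrr add0r.
by rewrite oppr_eq0 => /eqP ->; rewrite add0r.
Qed.

(** The adjoint representation; not obtained from [ahom], because the
    endomorphisms of g form a nontrivial ring only when g is nonzero. *)
Fixpoint adj_term (t : aterm K g) (y : g) : g :=
  match t with
  | AVar x => lie x y
  | AZero => 0
  | AOne => y
  | AOpp t => - adj_term t y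
  | AAdd t u => adj_term t y + adj_term u y
  | AScale a t => a *: adj_term t y
  | AMul t u => adj_term t (adj_term u y)
  end.

Lemma adj_term_linear t a x y :
  adj_term t (a *: x + y) = a *: adj_term t x + adj_term t y.
Proof.
elim: t a x y => [z|||t IH|t IHt u IHu|b t IH|t IHt u IHu] a x y //=.
- exact: lie_linearr.
- by rewrite scaler0 addr0.
- by rewrite IH opprD scalerN.
- by rewrite IHt IHu scalerDr addrACA.
- by rewrite IH scalerDr !scalerA [b * a]mulrC.
- by rewrite IHu IHt.
Qed.

Lemma lieDl (x y z : g) : lie (x + y) z = lie x z + lie y z.
Proof. by have := lie_linearl z 1 x y; rewrite !scale1r. Qed.
Lemma lieDr (x y z : g) : lie z (x + y) = lie z x + lie z y.
Proof. by have := lie_linearr z 1 x y; rewrite !scale1r. Qed.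
Lemma lie0l (x : g) : lie 0 x = 0.
Proof. by apply: (addrI (lie 0 x)); rewrite -lieDl !addr0. Qed.
Lemma lie0r (x : g) : lie x 0 = 0.
Proof. by apply: (addrI (lie x 0)); rewrite -lieDr !addr0. Qed.
Lemma lieZl a (x y : g) : lie (a *: x) y = a *: lie x y.
Proof. by have := lie_linearl y a x 0; rewrite lie0l !addr0. Qed.
Lemma lieC (x y : g) : lie x y = - lie y x.
Proof.
have := lie_alt (x + y); rewrite lieDl !lieDr !lie_alt add0r addr0.
by move/eqP; rewrite addr_eq0 => /eqP.
Qed.
Lemma lieNr (x y : g) : lie x (- y) = - lie x y.
Proof. by apply: (addrI (lie x y)); rewrite -lieDr !subrr lie0r. Qed.

(** This makes the adjoint representation well defined on U(g). Linearity of [adj_term] serves the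
    congruences moving sums and scalars out of the right factor, and the bracket relation is the
    Jacobi identity. *)
Lemma adj_term_cong t u :
  acong (lie_presentation g) t u -> forall y, adj_term t y = adj_term u y.
Proof.
have D v x y : adj_term v (x + y) = adj_term v x + adj_term v y.
  by have := adj_term_linear v 1 x y; rewrite !scale1r.
have D0 v : adj_term v 0 = 0 by apply: (addrI (adj_term v 0)); rewrite -D !addr0.
have Z v a x : adj_term v (a *: x) = a *: adj_term v x.
  by have := adj_term_linear v a x 0; rewrite D0 !addr0.
elim=> {t u} /=.
- by [].
- by move=> t u _ IH y; rewrite IH.
- by move=> t u w _ IH _ IH' y; rewrite IH.
- by move=> t u _ IH y; rewrite IH.
- by move=> t t' u u' _ IH _ IH' y; rewrite IH IH'.
- by move=> a t u _ IH y; rewrite IH.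
- by move=> t t' u u' _ IH _ IH' y; rewrite IH IH'.
- by move=> *; rewrite addrA.
- by move=> *; rewrite addrC.
- by move=> *; rewrite add0r.
- by move=> *; rewrite addNr.
- by move=> *; rewrite scalerA.
- by move=> *; rewrite scale1r.
- by move=> *; rewrite scalerDr.
- by move=> *; rewrite scalerDl.
- by [].
- by [].
- by [].
- by [].
- by move=> *; rewrite D.
- by [].
- by move=> *; rewrite Z.
- move=> t u [x y|a x|x y] z /=.
  + by rewrite lieDl.
  + by rewrite lieZl.
  + have := lie_jacobi x y z; rewrite [lie z (lie x y)]lieC [lie z x]lieC lieNr.
    by move/eqP; rewrite subr_eq0 => /eqP ->.
Qed.

(** The adjoint representation factors through U(g), so the kernel of g -> U(g) consists of central
    elements of g. *)
Lemma uincl_eq0 (x : g) : uincl x = 0 -> forall y, lie x y = 0.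
Proof. by move=> /apiP /adj_term_cong. Qed.

(** The line through a central element is an abelian ideal, hence solvable after one derivation. *)
Lemma semisimple_center (x : g) : semisimple g -> (forall y, lie x y = 0) -> x = 0.
Proof.
move=> ss cx; apply/eqP; rewrite -memv0 -(ss <[x]>%VS) ?memv_line //.
  by move=> y z /vlineP [a ->]; rewrite lieC lieZl cx scaler0 oppr0 mem0v.
exists 1%N => /=; apply/eqP; rewrite -subv0; apply/span_subvP => w /allpairsP.
case=> -[y z] /= [/vbasis_mem /vlineP [a ->] _ ->].
by rewrite lieZl cx scaler0 mem0v.
Qed.

(** The triviality of the centre is used twice: writing [u] as the image of x, each bracket [x, z]
    dies in U(g), so it is central by [uincl_eq0] and vanishes; then x itself is central. *)
Lemma primitive_central_eq0 (u : U) : [pchar K] =i pred0 -> semisimple g ->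
  primitive u -> (forall y, u * uincl y = uincl y * u) -> u = 0.
Proof.
move=> char0 ss /(primitive_uincl char0) [x ->] cx.
rewrite [x](semisimple_center ss) => [|y]; first by rewrite -(scale0r 0) uinclZ scale0r.
apply: semisimple_center => // z; apply: uincl_eq0.
by rewrite uincl_lie cx subrr.
Qed.

End EnvelopingHopf.

(** * h-adic Hopf algebras *)

Section Functional.
Context {K : comNzRingType} (V W : lmodType K) (phi : hser V -> hser K).
Hypothesis phiZ : hsemilinear id (phi : hser V -> hser K^o).

Let phi_scale a x : phi (hmap ( *:%R a) x) = hconst a * phi x.
Proof. by rewrite phiZ.2 -[hmap _ _](hscale_const (V := K^o)). Qed.

Lemma functional_bihadicl : bihadic (fun v (w : hser W) => phi v *: w).
Proof.
split=> [y|x|a x y]; first exact: (hscale_hadicl_comp y phiZ.1).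
  exact: hscale_hadicr.
by rewrite phi_scale -hscale_const scalerA mulrC.
Qed.

Lemma functional_bihadicr : bihadic (fun (w : hser W) v => phi v *: w).
Proof.
split=> [y|x|a x y]; first exact: hscale_hadicr.
  exact: (hscale_hadicl_comp x phiZ.1).
by rewrite phi_scale -hscale_const scalerA mulrC.
Qed.
End Functional.

Section HadicHopf.
Context {K : comNzRingType} (D : hadicHopf K).

Lemma hlinear_hsemilinear (V W : lmodType K) (f : {linear hser V -> hser W}) :
  hsemilinear id f.
Proof. by apply: hsemilinear_of_linear => // s x y; rewrite linearP. Qed.

Lemma hh_eps_hsemilinear : hsemilinear id (@hh_eps K D : hser D -> hser K^o).
Proof. by apply: hsemilinear_of_linear => // s x y; rewrite linearP. Qed.

Lemma counitl_bihadic :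
  bihadic (fun v w : hser D => (hh_eps D v : hser K) *: w).
Proof. exact: functional_bihadicl hh_eps_hsemilinear. Qed.

Lemma counitr_bihadic :
  bihadic (fun v w : hser D => (hh_eps D w : hser K) *: v).
Proof. exact: functional_bihadicr hh_eps_hsemilinear. Qed.

End HadicHopf.

#[export] Hint Extern 2 (hadic (GRing.Linear.sort _)) =>
  exact: (hsemilinear_hadic (hlinear_hsemilinear _)) : hadic.

Section Tassoc.
Context {K : comNzRingType} (U V W : lmodType K).

Lemma tassoc1_balanced (z : W) :
  balanced (fun (v : U) (w : V) => tpure v (tpure w z)).
Proof.
split=> [w v v'|v w w'|a v w]; rewrite ?tpureDl ?tpureDr //.
by rewrite -tpureZl tpureZr tpureZl.
Qed.

Lemma tassoc_balanced : balanced (fun (t : tensor U V) (z : W) =>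
  tlift (fun (v : U) (w : V) => tpure v (tpure w z)) t).
Proof.
split=> [z t t'|t z z'|a t z]; first exact: (tliftD (tassoc1_balanced z)).
  elim/tensor_ind: t => [|x IH|x y IHx IHy|v w].
  - by rewrite !(tlift0 (tassoc1_balanced _)) addr0.
  - by rewrite !(tliftN (tassoc1_balanced _)) IH opprD.
  - by rewrite !(tliftD (tassoc1_balanced _)) IHx IHy addrACA.
  - by rewrite !(tlift_pure (tassoc1_balanced _)) !tpureDr.
elim/tensor_ind: t => [|x IH|x y IHx IHy|v w].
- by rewrite scaler0 !(tlift0 (tassoc1_balanced _)).
- by rewrite scalerN !(tliftN (tassoc1_balanced _)) IH.
- by rewrite scalerDr !(tliftD (tassoc1_balanced _)) IHx IHy.
- by rewrite tpureZl !(tlift_pure (tassoc1_balanced _)) -tpureZr -tpureZl tpureZr.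
Qed.

Lemma tassoc_hadic : hadic (hmap (@tassoc K U V W)).
Proof. by apply: hmap_hadic; exact: (tliftD tassoc_balanced). Qed.

Lemma hmap_tassoc (x : hser U) (y : hser V) (z : hser W) :
  hmap (@tassoc K U V W) (hpure (hpure x y) z) = hpure x (hpure y z).
Proof.
have ah := tassoc_hadic; move: x.
apply: hadic_ext => [||u].
- by apply: (hadic_comp ah); do 2! apply: hpure_hadicl_comp.
- exact: hpure_hadicl.
move: y z; apply: hadic_ext2 => [z|y|z|y|v w].
- by apply: (hadic_comp ah); apply: hpure_hadicl_comp; exact: hpure_hadicr.
- by apply: (hadic_comp ah); exact: hpure_hadicr.
- by apply: (hadic_comp (hpure_hadicr _ _)); exact: hpure_hadicl.
- by apply: (hadic_comp (hpure_hadicr _ _)); exact: hpure_hadicr.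
rewrite !hpure_const hmap_const; last exact: (tliftD tassoc_balanced).
by rewrite /tassoc (tlift_pure tassoc_balanced) (tlift_pure (tassoc1_balanced _)).
Qed.

End Tassoc.

(** * The identity S star S star = id in an h-adic Hopf star-algebra *)

Section AntipodeStar.
Context {C : numClosedFieldType}.

Lemma hconj_linear_hsemilinear (V : lmodType C) (f : hser V -> hser V) :
  hconj_linear f -> hsemilinear Num.conj f.
Proof. by apply: hsemilinear_of_linear; [exact: conjC0|exact: conjC1]. Qed.

Variables (D : hadicHopf C) (st : hser D -> hser D).
Hypothesis stP : hadic_hopf_star st.
Hypothesis S1 : hh_S D (hh_one D) = hh_one D.
Hypothesis SM : forall x y, hh_S D (hh_prod x y) = hh_prod (hh_S D y) (hh_S D x).

Let stZ : hsemilinear Num.conj st.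
Proof. by case: stP => /hconj_linear_hsemilinear. Qed.
Let stK : involutive st. Proof. by case: stP. Qed.
Let stM x y : st (hh_prod x y) = hh_prod (st y) (st x). Proof. by case: stP. Qed.
Let st1 : st (hh_one D) = hh_one D.
Proof. by rewrite -[LHS]hh_mul1l -{1}(stK (hh_one D)) -stM hh_mul1l stK. Qed.

(** The map to be identified with the identity; it is linear because the two conjugations cancel. *)
Let P x := hh_S D (st (hh_S D (st x))).
Let SS := hlinear_hsemilinear (@hh_S C D).
Let PZ : hsemilinear id P.
Proof.
split=> [|a x]; first by rewrite /P; hadic_tac.
by rewrite /P stZ.2 SS.2 stZ.2 SS.2 /= conjCK.
Qed.
Let idZ := @hsemilinear_id C D.
Let mulZ := hlinear_hsemilinear (@hh_mul C D).
Let deltaZ := hlinear_hsemilinear (@hh_delta C D).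

Let e x : hser C := hconj (hh_eps D (st x)).
Let conj_hadic : hadic (@hconj C).
Proof. by apply: hmap_hadic => x y; rewrite rmorphD. Qed.
Let eps_hadic : hadic (@hh_eps C D : hser D -> hser C).
Proof. exact: (hsemilinear_hadic (hh_eps_hsemilinear D)). Qed.

Let stZ_scale s x : st (s *: x) = hconj s *: st x.
Proof.
by case: stP => stL _ _ _; have := stL s x 0; rewrite (hadic0 stZ.1) !addr0.
Qed.

(* Convolving this identity with id on the right recovers P on one side and, by
   the counit axiom, the identity on the other. *)
Let P_conv x : hh_mul D (htens P (hh_S D) (hh_delta D x)) = e x *: hh_one D.
Proof.
have := hh_antipodel (st x) => /(congr1 (fun y => hh_S D (st y))).
rewrite stZ_scale st1 linearZ /= S1 => <-.
case: stP => _ _ _ ->; move: (hh_delta D x).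
apply: tensor_hadic_ext => [||v w].
- by hadic_tac.
- by hadic_tac.
rewrite !(htens_pure PZ SS, htens_pure stZ stZ, htens_pure SS idZ).
by rewrite -/(hh_prod _ _) -/(hh_prod _ (st w)) stM stK SM.
Qed.

Let e_hsemilinear : hsemilinear id (fun y => e y *: hh_one D).
Proof.
split.
  apply: hscale_hadicl_comp; rewrite /e.
  by apply: (hadic_comp conj_hadic); apply: (hadic_comp eps_hadic); exact: stZ.1.
move=> a x; rewrite -!hscale_const scalerA; congr (_ *: _).
rewrite /e stZ_scale linearZ /=.
rewrite [_ *: _](_ : _ = hconj (hconst a) * hh_eps D (st x)) //.
have hM : {morph @hconj C : u v / u * v}.
  by apply: hmapM => ? ?; rewrite (rmorphD, rmorphM).
by rewrite hM; congr (_ * _); apply/funext => n; rewrite /hconj /hmap conjCK.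
Qed.

(** Obtained by applying the star to the left counit axiom at [st x]. *)
Let e_counit x :
  hh_mul D (htens (fun y => e y *: hh_one D) id (hh_delta D x)) = x.
Proof.
rewrite -[RHS]stK -[in RHS](hh_counitl (st x)).
case: stP => _ _ _ ->; move: (hh_delta D x).
have cl := hlift_hadic (counitl_bihadic D).
apply: tensor_hadic_ext => [||v w].
- by hadic_tac.
- by apply: (hadic_comp stZ.1); apply: (hadic_comp cl); hadic_tac.
rewrite (htens_pure e_hsemilinear idZ) (htens_pure stZ stZ).
rewrite (hlift_pure (counitl_bihadic D)) stZ_scale stK.
by rewrite hpure_scalel linearZ /= -/(hh_prod _ _) hh_mul1l.
Qed.

(** Uniqueness of convolution inverses. With convolution written as a dot, P = P . (S . id) = (P .
    S) . id = e . id = id, where P . S = e is [P_conv]. *)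
Lemma antipode_star x : hh_S D (st (hh_S D (st x))) = x.
Proof.
rewrite -[RHS]e_counit.
have PSZ : hsemilinear id (fun y => hh_mul D (htens P (hh_S D) (hh_delta D y))).
  have -> : (fun y => hh_mul D (htens P (hh_S D) (hh_delta D y))) =
            (fun y => e y *: hh_one D) by apply/funext => y; exact: P_conv.
  exact: e_hsemilinear.
have -> : htens (fun y => e y *: hh_one D) id =
    htens (fun y => hh_mul D (htens P (hh_S D) (hh_delta D y))) (@id (hser D)).
  by congr htens; apply/funext => y; rewrite P_conv.
have SiZ := hsemilinear_comp mulZ (htens_hsemilinear SS idZ).
have PiZ := hsemilinear_comp mulZ (htens_hsemilinear PZ SS).
have epsZ : hsemilinear id (fun y => hh_mul D (htens (hh_S D) id (hh_delta D y))).
  exact: (hsemilinear_comp SiZ deltaZ).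
have assoc_hadic := tassoc_hadic D D D.
(* The threefold convolution of P, S and id, as a map on the triple tensor product bracketed to the
   right. *)
pose Th s := hh_mul D (htens P (fun y => hh_mul D (htens (hh_S D) id y)) s).
have Th_hadic : hadic Th by rewrite /Th; hadic_tac.
(* In this bracketing S . id collapses to the counit, and the right counit axiom leaves P. *)
transitivity (Th (htens id (hh_delta D) (hh_delta D x))).
  rewrite -[in LHS](hh_counitr x) -/(P _); move: (hh_delta D x).
  have cr := hlift_hadic (counitr_bihadic D).
  apply: tensor_hadic_ext => [||v w].
  - by apply: (hadic_comp PZ.1).
  - by apply: (hadic_comp Th_hadic); apply: htens_hadic deltaZ.
  rewrite (hlift_pure (counitr_bihadic D)) (htens_pure idZ deltaZ) /Th.
  rewrite (htens_pure PZ SiZ) hh_antipodel hpure_scaler linearZ /= -/(hh_prod _ _) hh_mul1r.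
  exact: hsemilinearZ PZ _ _.
(* By coassociativity the first two factors may be convolved first, which produces P . S. *)
rewrite -hh_coassoc; move: (hh_delta D x).
apply: tensor_hadic_ext => [||v w].
- by apply: (hadic_comp Th_hadic); apply: (hadic_comp assoc_hadic); apply: htens_hadic idZ.
- by apply: (hadic_comp mulZ.1); apply: htens_hadic idZ.
rewrite (htens_pure deltaZ idZ) (htens_pure PSZ idZ); move: (hh_delta D v).
apply: tensor_hadic_ext => [||a b].
- by apply: (hadic_comp Th_hadic); apply: (hadic_comp assoc_hadic); exact: hpure_hadicl.
- by apply: (hadic_comp mulZ.1); apply: hpure_hadicl_comp; exact: PiZ.1.
rewrite hmap_tassoc /Th (htens_pure PZ SiZ) (htens_pure SS idZ) (htens_pure PZ SS).
by rewrite -/(hh_prod (P a) (hh_S D b)) -/(hh_prod (hh_S D b) w) -/(hh_prod _ w)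
  -/(hh_prod (P a) _) hh_mulA.
Qed.

End AntipodeStar.

Section Tmap.
Context {K : comNzRingType} (theta : K -> K) (V W V' W' : lmodType K).
Variables (f : V -> V') (g : W -> W').
Hypotheses (fD : {morph f : x y / x + y}) (gD : {morph g : x y / x + y}).
Hypotheses (fZ : forall a x, f (a *: x) = theta a *: f x)
           (gZ : forall a x, g (a *: x) = theta a *: g x).

Lemma tmap_balanced : balanced (fun v w => tpure (f v) (g w)).
Proof.
split=> [w v v'|v w w'|a v w]; first by rewrite fD tpureDl.
  by rewrite gD tpureDr.
by rewrite fZ gZ tpure_bal.
Qed.

Lemma tmapD : {morph tmap f g : s t / s + t}.
Proof. exact: tliftD tmap_balanced. Qed.

Lemma hmap_tmap_pure x y : hmap (tmap f g) (hpure x y) = hpure (hmap f x) (hmap g y).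
Proof.
have [[th fh] gh] := (hmap_hadic tmapD, hmap_hadic fD, hmap_hadic gD).
move: x y; apply: hadic_ext2 => [y|x|y|x|v w]; try by hadic_tac.
rewrite hpure_const !hmap_const //; last exact: tmapD.
by rewrite hpure_const; congr hconst; exact: (tlift_pure tmap_balanced).
Qed.
End Tmap.

Section Flip.
Context {K : comNzRingType} (V W : lmodType K).

Lemma tflip_balanced : balanced (fun (v : V) (w : W) => tpure w v).
Proof.
by split=> [w v v'|v w w'|a v w]; rewrite ?tpureDl ?tpureDr ?tpure_bal.
Qed.

Lemma hmap_tflip_hadic : hadic (hmap (@tflip K V W)).
Proof. by apply: hmap_hadic; exact: (tliftD tflip_balanced). Qed.

Lemma hmap_tflip_pure (x : hser V) (y : hser W) :
  hmap (@tflip K V W) (hpure x y) = hpure y x.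
Proof.
have fh := hmap_tflip_hadic.
move: x y; apply: hadic_ext2 => [y|x|y|x|v w]; try by hadic_tac.
rewrite !hpure_const hmap_const; last exact: (tliftD tflip_balanced).
by congr hconst; exact: (tlift_pure tflip_balanced).
Qed.
End Flip.

(** * Contraction of one tensor leg with the counit of U(g) *)

Section ClassicalCounit.
Context {K : fieldType} (g : lieAlgebra K).
Local Notation U := (enveloping g).
Local Notation eps := (hmap (@ueps K g)).

Lemma hmap_ueps_hsemilinear : hsemilinear id (eps : hser U -> hser K^o).
Proof. by apply: hmap_hsemilinear; [exact: uepsD|exact: uepsZ]. Qed.

Lemma hmap_uepsM : {morph eps : x y / x * y}.
Proof. by apply: hmapM; [exact: uepsD|exact: uepsM]. Qed.

Lemma hmap_uepsZ s x : eps (s *: x) = s * eps x.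
Proof. exact: (hsemilinearZ hmap_ueps_hsemilinear). Qed.

Lemma counitl_tensor_balanced : balanced (fun a b : U => ueps a *: b).
Proof.
split=> [w v v'|v w w'|a v w]; rewrite ?uepsD ?scalerDl ?scalerDr //.
by rewrite uepsZ scalerA mulrC.
Qed.

Lemma counitr_tensor_balanced : balanced (fun a b : U => ueps b *: a).
Proof.
split=> [w v v'|v w w'|a v w]; rewrite ?uepsD ?scalerDl ?scalerDr //.
by rewrite uepsZ scalerA mulrC.
Qed.

Definition epsl := hmap (tlift (fun a b : U => ueps a *: b)).
Definition epsr := hmap (tlift (fun a b : U => ueps b *: a)).

Lemma epsl_hadic : hadic epsl.
Proof. by apply: hmap_hadic; exact: (tliftD counitl_tensor_balanced). Qed.
Lemma epsr_hadic : hadic epsr.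
Proof. by apply: hmap_hadic; exact: (tliftD counitr_tensor_balanced). Qed.

Lemma epsl_pure x y : epsl (hpure x y) = eps x *: y.
Proof.
have [bl br _] := functional_bihadicl U hmap_ueps_hsemilinear.
move: x y; apply: hadic_ext2 => // [y|x|v w].
- by apply: (hadic_comp epsl_hadic); exact: hpure_hadicl.
- by apply: (hadic_comp epsl_hadic); exact: hpure_hadicr.
rewrite hpure_const /epsl hmap_const; last exact: (tliftD counitl_tensor_balanced).
rewrite (tlift_pure counitl_tensor_balanced) hmap_const; last exact: uepsD.
by rewrite hscale_const hmap_const // => ? ?; rewrite scalerDr.
Qed.

Lemma epsr_pure x y : epsr (hpure x y) = eps y *: x.
Proof.
have [bl br _] := functional_bihadicr U hmap_ueps_hsemilinear.
move: x y; apply: hadic_ext2 => // [y|x|v w].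
- by apply: (hadic_comp epsr_hadic); exact: hpure_hadicl.
- by apply: (hadic_comp epsr_hadic); exact: hpure_hadicr.
rewrite hpure_const /epsr hmap_const; last exact: (tliftD counitr_tensor_balanced).
rewrite (tlift_pure counitr_tensor_balanced) hmap_const; last exact: uepsD.
by rewrite hscale_const hmap_const // => ? ?; rewrite scalerDr.
Qed.

Lemma epslM : {morph epsl : s t / s * t}.
Proof.
have lh := epsl_hadic; move=> s t; move: s; apply: tensor_hadic_ext => [||x y].
- by apply: (hadic_comp lh); exact: hmul_hadicl.
- exact: hmul_hadicl_comp.
move: t; apply: tensor_hadic_ext => [||x' y'].
- by apply: (hadic_comp lh); exact: hmul_hadicr.
- by apply: (hadic_comp (hmul_hadicr _)).
by rewrite hpureM !epsl_pure hmap_uepsM -scalerAl -scalerAr scalerA.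
Qed.

Lemma epsrM : {morph epsr : s t / s * t}.
Proof.
have lh := epsr_hadic; move=> s t; move: s; apply: tensor_hadic_ext => [||x y].
- by apply: (hadic_comp lh); exact: hmul_hadicl.
- exact: hmul_hadicl_comp.
move: t; apply: tensor_hadic_ext => [||x' y'].
- by apply: (hadic_comp lh); exact: hmul_hadicr.
- by apply: (hadic_comp (hmul_hadicr _)).
by rewrite hpureM !epsr_pure hmap_uepsM -scalerAl -scalerAr scalerA.
Qed.

Let eps1 : eps 1 = 1.
Proof. by apply: hmap1; [exact: uepsD|exact: ueps1]. Qed.
Lemma epsl1 : epsl 1 = 1. Proof. by rewrite -hpure1 epsl_pure eps1 scale1r. Qed.
Lemma epsr1 : epsr 1 = 1. Proof. by rewrite -hpure1 epsr_pure eps1 scale1r. Qed.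

Lemma epsl_udelta x : epsl (hmap (@udelta K g) x) = x.
Proof.
apply/funext => n; rewrite /epsl /hmap; move: (x n).
have D := tliftD counitl_tensor_balanced; have P := tlift_pure counitl_tensor_balanced.
pose f := tlift (fun a b : U => ueps a *: b).
have fZ a t : f (a *: t) = a *: f t.
  elim/tensor_ind: t => [|s IH|s t IHs IHt|v w].
  - by rewrite scaler0 /f (tlift0 counitl_tensor_balanced) scaler0.
  - by rewrite scalerN /f !(tliftN counitl_tensor_balanced) -/f IH scalerN.
  - by rewrite scalerDr /f !D -/f IHs IHt scalerDr.
  - by rewrite tpureZl /f !P uepsZ scalerA.
(* Multiplicativity of [f] is the constant coefficient of [epslM] on constant series. *)
have fM s t : f (s * t) = f s * f t.
  have := congr1 (@^~ 0%N) (epslM (hconst s) (hconst t)).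
  by rewrite /epsl hmul_const !hmap_const // hmul_const.
rewrite -/f; elim/(presalg_ind (P := lie_presentation g))=>
  [z||u v IHu IHv|a u IH|u v IHu IHv].
- rewrite -[agen _ z]/(uincl z) udelta_uincl /f D !P ueps_uincl ueps1.
  by rewrite scale0r add0r scale1r.
- by rewrite udelta1 /f P ueps1 scale1r.
- by rewrite udeltaD /f D -/f IHu IHv.
- by rewrite udeltaZ fZ IH.
- by rewrite udeltaM fM IHu IHv.
Qed.

End ClassicalCounit.

(** * Group-like series and star structures over U(g) *)

Section ClassicalStar.
Context {C : numClosedFieldType} (g : lieAlgebra C).
Local Notation U := (enveloping g).

(** Every middle term of the Cauchy sum contains a vanishing coefficient; the two end terms have a
    leg equal to [u 0], which is 1. *)
Lemma udelta_primitiveP (u v : hser U) n : (0 < n)%N -> u 0%N = 1 ->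
  (forall k, (0 < k < n)%N -> u k = 0) ->
  hpure u u n = tpure (u n) 1 + tpure 1 (u n).
Proof.
case: n => // n _ u0 uk; rewrite /hpure big_ord_recl big_ord_recr /= subn0 subnn.
rewrite u0 big1 ?add0r 1?addrC // => i _.
by rewrite uk /bump /= ?add1n ?ltnS ?ltn_ord // -[0]/(0 : U) -(scale0r 1) -tpureZl scale0r.
Qed.

(** If the coefficients strictly between 0 and n vanish, the n-th one is primitive by
    [udelta_primitiveP] and central, hence zero since g is semisimple. *)
Lemma central_grouplike_eq1 (d : hser U) : semisimple g -> d 0%N = 1 ->
  hmap (@udelta C g) d = hpure d d -> (forall x, d * x = x * d) -> d = 1.
Proof.
move=> ss d0 dd cd.
have dn n : (0 < n)%N -> d n = 0.
  elim/ltn_ind: n => n IH n0.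
  apply: (@primitive_central_eq0 C g) ss _ _; first exact: pchar_num.
    rewrite /primitive -udelta_primitiveP //; first by rewrite -dd.
    by move=> k /andP [k0 kn]; apply: IH.
  (* Commutation of [d] with the constant series of y, read in degree n, is commutation of [d n]
     with y. *)
  move=> y; have /(congr1 (@^~ n)) := cd (hconst (uincl y)).
  rewrite !hserM big_ord_recr big_ord_recl /= subnn subn0.
  rewrite big1 => [|i _]; last first.
    rewrite [hconst _ _](_ : _ = 0) ?mulr0 // /hconst.
    by case: (n - i)%N (subn_gt0 i n) => //; rewrite ltn_ord.
  by rewrite big1 ?add0r ?addr0 // => i _; rewrite mul0r.
by apply/funext => -[|n]; [exact: d0|exact: dn].
Qed.

Variable st : U -> U.
Hypothesis stP : hopf_star st.

Lemma hopf_starD : {morph st : x y / x + y}.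
Proof. by case: stP => L _ _ _ x y; have := L 1 x y; rewrite conjC1 !scale1r. Qed.
Lemma hopf_starZ a x : st (a *: x) = Num.conj a *: st x.
Proof.
have st0 : st 0 = 0 by apply: (addrI (st 0)); rewrite -hopf_starD !addr0.
by case: stP => L _ _ _; have := L a x 0; rewrite st0 !addr0.
Qed.
Lemma hopf_starM : {morph st : x y / x * y >-> y * x}.
Proof. by case: stP. Qed.
Lemma hopf_starK : involutive st.
Proof. by case: stP. Qed.
Lemma hopf_star1 : st 1 = 1.
Proof. by rewrite -[LHS]mul1r -{1}(hopf_starK 1) -hopf_starM mul1r hopf_starK. Qed.

(** The star of an element of g is primitive, hence again lies in g, where the antipode is -1. The
    identity then spreads from generators, the two stars and the conjugations compensating each
    other. *)
Lemma star_uS u : st (uS (st u)) = uS u.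
Proof.
elim/(presalg_ind (P := lie_presentation g)): u => [x||u v IHu IHv|a u IH|u v IHu IHv].
- rewrite -[agen _ x]/(uincl x).
  have [|y sty] := @primitive_uincl C g (st (uincl x)) (pchar_num _).
    rewrite /primitive; case: stP => _ _ _ ->; rewrite udelta_uincl.
    have tD := tmapD hopf_starD hopf_starD hopf_starZ hopf_starZ.
    have tP := tlift_pure (tmap_balanced hopf_starD hopf_starD hopf_starZ hopf_starZ).
    by rewrite tD /tmap !tP hopf_star1.
  by rewrite sty !uS_uincl -[- uincl y]scaleN1r hopf_starZ -sty hopf_starK
    rmorphN rmorph1 scaleN1r.
- by rewrite hopf_star1 uS1 hopf_star1.
- by rewrite hopf_starD !uSD hopf_starD IHu IHv.
- by rewrite hopf_starZ !uSZ hopf_starZ IH conjCK.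
- by rewrite hopf_starM !uSM hopf_starM IHu IHv.
Qed.

Lemma hmap_star_hsemilinear : hsemilinear Num.conj (hmap st).
Proof. by apply: hmap_hsemilinear; [exact: hopf_starD|exact: hopf_starZ]. Qed.

Lemma hmap_starM : {morph hmap st : x y / x * y >-> y * x}.
Proof. by apply: hmapM_anti; [exact: hopf_starD|exact: hopf_starM]. Qed.
Lemma hmap_starK : involutive (hmap st).
Proof. by move=> x; apply/funext => n; apply: hopf_starK. Qed.
Lemma hmap_star1 : hmap st 1 = 1.
Proof. by apply: hmap1; [exact: hopf_starD|exact: hopf_star1]. Qed.

End ClassicalStar.

(** * Transport of the Hopf structure along alpha *)

Section Transfer.
Context {C : numClosedFieldType} (g : lieAlgebra C).
Local Notation U := (enveloping g).
Variables (st : U -> U) (D : hadicHopf C) (stD : hser D -> hser D).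
Variables (alpha : {linear hser D -> hser U}) (alpha' : hser U -> hser D).
Hypotheses (stP : hopf_star st) (stDP : hadic_hopf_star stD).
Hypotheses (alphaK : cancel alpha alpha') (alpha'K : cancel alpha' alpha).
Hypothesis alpha1 : alpha (hh_one D) = 1.
Hypothesis alphaM : forall x y, alpha (hh_prod x y) = alpha x * alpha y.
Hypothesis alpha_star : forall x, alpha (stD x) = hmap st (alpha x).

Let H := transferred_hopf st alpha alpha'.
Let aZ := hlinear_hsemilinear alpha.
Let a'Z : hsemilinear id alpha'.
Proof.
apply: hsemilinear_of_linear => // s x y; apply: (can_inj alphaK).
by rewrite linearP !alpha'K.
Qed.
Let idZ := @hsemilinear_id C D.
Let epsZ := hh_eps_hsemilinear D.
Let stZ := hmap_star_hsemilinear stP.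
Let stDZ : hsemilinear Num.conj stD.
Proof. by case: stDP => /hconj_linear_hsemilinear. Qed.

Lemma transferred_delta_star x : hs_delta H (hmap st x) =
  htens (hmap st) (hmap st) (hs_delta H x).
Proof.
rewrite /H /= -{1}[x]alpha'K -alpha_star alphaK.
case: stDP => _ _ _ ->; move: (hh_delta D _).
apply: tensor_hadic_ext => [||v w].
- by apply: (hadic_comp (htens_hadic aZ aZ)); exact: htens_hadic stDZ stDZ.
- by apply: (hadic_comp (htens_hadic stZ stZ)); exact: htens_hadic aZ aZ.
by rewrite (htens_pure stDZ stDZ) !(htens_pure aZ aZ) (htens_pure stZ stZ) !alpha_star.
Qed.

Lemma transferred_eps_hsemilinear :
  hsemilinear id (hs_eps H : hser U -> hser C^o).
Proof. exact: (hsemilinear_comp epsZ a'Z). Qed.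

Lemma transferred_counitr x :
  hlift (fun v w : U => hs_eps H (hconst w) *: hconst v) (hs_delta H x) = x.
Proof.
have br := functional_bihadicr U transferred_eps_hsemilinear.
have dr := counitr_bihadic D.
rewrite -[RHS]alpha'K -[in RHS](hh_counitr (alpha' x)) /H /=.
move: (hh_delta D _); apply: tensor_hadic_ext => [||v w].
- by apply: (hadic_comp (hlift_hadic br)); exact: htens_hadic aZ aZ.
- by apply: (hadic_comp aZ.1); exact: hlift_hadic dr.
by rewrite (htens_pure aZ aZ) (hlift_pure br) (hlift_pure dr) linearZ /= alphaK.
Qed.

(** For a group-like element of counit 1 the antipode axioms say that the antipode is its two-sided
    inverse. *)
Lemma transferred_grouplike (c : hser U) : c 0%N = 1 ->
  hs_delta H c = hpure c c -> inverses c (hs_S H c).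
Proof.
move=> c0 dc; set d := alpha' c.
have dd : hh_delta D d = hpure d d.
  have := congr1 (htens alpha' alpha') dc.
  rewrite (htens_pure a'Z a'Z) -/d /H /= => <-; rewrite -/d.
  move: (hh_delta D d); apply: tensor_hadic_ext => // [|v w].
    by apply: (hadic_comp (htens_hadic a'Z a'Z)); exact: htens_hadic aZ aZ.
  by rewrite (htens_pure aZ aZ) (htens_pure a'Z a'Z) !alphaK.
(* The counit axiom only gives eps(d) c = c; cancelling c is allowed because its constant
   coefficient is 1. *)
have eps1 : (hh_eps D d : hser C) = 1.
  have := hh_counitl d; rewrite dd (hlift_pure (counitl_bihadic D)) => /(congr1 alpha).
  rewrite linearZ /= alpha'K => ec; apply/eqP; rewrite -subr_eq0; apply/eqP.
  by apply: (hscale_eq0 (x := c)); rewrite ?c0 ?oner_eq0 // scalerBl ec scale1r subrr.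
have SS := hlinear_hsemilinear (@hh_S C D).
have := hh_antipodel d; have := hh_antipoder d; rewrite eps1 scale1r dd.
rewrite (htens_pure SS idZ) (htens_pure idZ SS) -!/(hh_prod _ _).
move=> /(congr1 alpha) cS /(congr1 alpha); move: cS.
by rewrite !alphaM alpha1 alpha'K => cS Sc; split.
Qed.

Lemma transferred_S_star :
  (forall x y, hs_S H (x * y) = hs_S H y * hs_S H x) -> hs_S H 1 = 1 ->
  forall x, hs_S H (hmap st (hs_S H (hmap st x))) = x.
Proof.
move=> SM S1 x.
have S1' : hh_S D (hh_one D) = hh_one D.
  by apply: (can_inj alphaK); rewrite -[X in hh_S D X]alphaK alpha1.
have SM' v w : hh_S D (hh_prod v w) = hh_prod (hh_S D w) (hh_S D v).
  apply: (can_inj alphaK); rewrite alphaM.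
  by have := SM (alpha v) (alpha w); rewrite /H /= -alphaM !alphaK.
have stDE z : stD z = alpha' (hmap st (alpha z)) by rewrite -alpha_star alphaK.
by have := congr1 alpha (antipode_star stDP S1' SM' (alpha' x)); rewrite !stDE !alpha'K.
Qed.

End Transfer.

(** * Twisting *)

Section Twist.
Context {C : numClosedFieldType} (g : lieAlgebra C).
Local Notation U := (enveloping g).
Variables (st : U -> U) (D : hadicHopf C) (stD : hser D -> hser D).
Variables (p : {linear D -> U}).
Variables (alpha : {linear hser D -> hser U}) (alpha' : hser U -> hser D).
Variables (F : hser (tensor U U)) (sigma : hser U).
Let H := transferred_hopf st alpha alpha'.
Hypotheses (ss : semisimple g) (stP : hopf_star st) (stDP : hadic_hopf_star stD).
Hypothesis alphaP : star_algebra_iso stD st p alpha alpha'.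
Hypotheses (FP : drinfeld_twist H F) (sP : antipode_twist H sigma).

Let Fi := inverse F.
Let si := inverse sigma.
Let S := hmap (@uS C g).
Local Notation star := (hmap st).

Let grouplike (c : hser U) : c 0%N = 1 -> hs_delta H c = hpure c c ->
  inverses c (hs_S H c).
Proof.
case: alphaP => -[aK a'K] a1 aM _ _.
exact: transferred_grouplike.
Qed.

Lemma twist_inverses : inverses F Fi.
Proof. by case: FP => FV _ _ _; exact: inverse_inverses. Qed.

Let FFi : F * Fi = 1 := proj1 twist_inverses.
Let FiF : Fi * F = 1 := proj2 twist_inverses.

Let sP0 : sigma 0%N = 1. Proof. by case: sP. Qed.
Let sPd : hs_delta H sigma = hpure sigma sigma. Proof. by case: sP. Qed.
Let sPS x : hs_S H x = sigma * S x * si. Proof. by case: sP. Qed.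

(** [inverse] returns its argument when there is no inverse, so invertibility has to be shown:
    group-likeness supplies the transferred antipode of [sigma] as an inverse. *)
Lemma antipode_twist_inverses : inverses sigma si.
Proof. by apply: inverse_inverses; exists (hs_S H sigma); exact: grouplike. Qed.

Let ssi : sigma * si = 1 := proj1 antipode_twist_inverses.
Let sis : si * sigma = 1 := proj2 antipode_twist_inverses.

Let deltaE x : hs_delta H x = F * hmap (@udelta C g) x * Fi.
Proof. by case: FP. Qed.

Let udM : {morph hmap (@udelta C g) : x y / x * y}.
Proof. by apply: hmapM; [exact: udeltaD|exact: udeltaM]. Qed.

Lemma transferred_deltaM x y : hs_delta H (x * y) = hs_delta H x * hs_delta H y.
Proof. by rewrite !deltaE udM !mulrA -[_ * Fi * F]mulrA FiF mulr1. Qed.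

Lemma transferred_delta1 : hs_delta H 1 = 1.
Proof. by rewrite deltaE hmap1 ?mulr1 //; [exact: udeltaD|exact: udelta1]. Qed.

(** Multiply the coproduct of [y] on the left by 1 = (y (x) y)(x (x) x) and use multiplicativity of
    the transferred coproduct. *)
Lemma grouplike_inverse x y : inverses x y -> hs_delta H x = hpure x x ->
  hs_delta H y = hpure y y.
Proof.
move=> [xy yx] dx.
rewrite -[LHS]mul1r -hpure1 -yx -hpureM -dx -mulrA -transferred_deltaM xy.
by rewrite transferred_delta1 mulr1.
Qed.

Let SM : {morph S : x y / x * y >-> y * x}.
Proof. by apply: hmapM_anti; [exact: uSD|exact: uSM]. Qed.
Let S1 : S 1 = 1. Proof. by apply: hmap1; [exact: uSD|exact: uS1]. Qed.
Let SK x : S (S x) = x. Proof. by apply/funext => n; exact: uS_involutive. Qed.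
Let stS x : star (S (star x)) = S x. Proof. by apply/funext => n; exact: star_uS. Qed.
Let stM := hmap_starM stP.
Let st1 := hmap_star1 stP.
Let stK := hmap_starK stP.

Lemma S_star x : star (S x) = S (star x).
Proof. by rewrite -stS stK. Qed.

Let sts : inverses (star sigma) (star si).
Proof. by split; rewrite -stM ?ssi ?sis st1. Qed.

Let sts_delta : hs_delta H (star sigma) = hpure (star sigma) (star sigma).
Proof.
case: alphaP => -[aK a'K] _ _ a_st _.
rewrite (transferred_delta_star stP stDP aK a'K a_st) -/H sPd.
by rewrite (htens_pure (hmap_star_hsemilinear stP) (hmap_star_hsemilinear stP)).
Qed.

Let sts0 : star sigma 0%N = 1.
Proof. by rewrite /hmap sP0; exact: hopf_star1. Qed.

(** The transferred antipode of [sigma] is sigma S(sigma) sigma^-1 and inverts [sigma], so sigma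
    S(sigma) = 1. *)
Lemma antipode_twist_S : S sigma = si.
Proof.
have [_] := grouplike sP0 sPd; rewrite sPS -!mulrA sis mulr1 => sS.
by rewrite -[LHS]mul1r -sis -mulrA sS mulr1.
Qed.

Lemma antipode_twist_selfadjoint : star sigma = sigma.
Proof.
case: sts => ts st'.
(* The goal is d = 1; [e] is going to be the inverse of [d]. *)
set d := star si * sigma; set e := S (star si) * si.
(* The star of [sigma] is group-like too, so its transferred antipode sigma S(star sigma) sigma^-1
   equals its inverse. *)
have dE : d = sigma * S (star sigma).
  have [_] := grouplike sts0 sts_delta; rewrite sPS => SS.
  have -> : d = sigma * S (star sigma) * si * (star sigma * star si) * sigma.
    by rewrite !mulrA SS mul1r.
  by rewrite ts mulr1 -mulrA sis mulr1.
have de : d * e = 1.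
  by rewrite dE /e !mulrA -[_ * S _ * S _]mulrA -SM st' S1 mulr1.
have ed : e * d = 1.
  by rewrite dE /e !mulrA -[_ * si * sigma]mulrA sis mulr1 -SM ts S1.
(* Expanding both transferred antipodes in S_h star S_h star = id turns the composite into
   conjugation by [d], so [d] is central. *)
have dx x : d * x * e = x.
  have S_anti u v : hs_S H (u * v) = hs_S H v * hs_S H u.
    by rewrite !sPS SM !mulrA -[_ * si * sigma]mulrA sis mulr1.
  have S_1 : hs_S H 1 = 1 by rewrite sPS S1 mulr1.
  case: alphaP => -[aK a'K] a1 aM a_st _.
  have := transferred_S_star stDP aK a'K a1 aM a_st S_anti S_1 x.
  rewrite -/H !sPS !stM S_star stK !SM SK => {2}<-.
  by rewrite dE /e !mulrA.
have cd x : d * x = x * d by rewrite -[LHS]mulr1 -ed mulrA dx.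
have dd : hs_delta H d = hpure d d.
  by rewrite transferred_deltaM (grouplike_inverse sts sts_delta) sPd hpureM.
(* Since d (x) d commutes with F, conjugation by the twist does not alter it, and [d] is group-like
   for the undeformed coproduct as well. *)
have hd : hmap (@udelta C g) d = hpure d d.
  have cdd t : hpure d d * t = t * hpure d d.
    move: t; apply: tensor_hadic_ext => [||v w]; first exact: hmul_hadicr.
      exact: hmul_hadicl.
    by rewrite !hpureM !cd.
  have -> : hmap (@udelta C g) d = Fi * hs_delta H d * F.
    by rewrite deltaE !mulrA FiF mul1r -mulrA FiF mulr1.
  by rewrite dd -mulrA cdd mulrA FiF mul1r.
have d0 : d 0%N = 1.
  have : star si 0%N * star sigma 0%N = 1.
    by have := congr1 (@^~ 0%N) st'; rewrite hserM big_ord1.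
  by rewrite sts0 mulr1 /d hserM big_ord1 sP0 mulr1.
have d1 := central_grouplike_eq1 ss d0 hd cd.
by rewrite -[LHS]mulr1 -d1 /d mulrA ts mul1r.
Qed.

(** * The twisted module star-algebra *)

Section Module.
Variables (W : lmodType C) (act : hser U -> hser W -> hser W).
Variables (mu : hser (tensor W W) -> hser W) (stX : hser W -> hser W).
Hypothesis real : real_twist st F.
Hypothesis XP : module_star_algebra (classical_hopf st) act mu stX.

Let actl x : hsemilinear id (fun a => act a x).
Proof. by case: XP => -[L _ _ _] _ _ _ _; apply: hsemilinear_of_linear. Qed.
Let actr a : hsemilinear id (act a).
Proof. by case: XP => -[_ L _ _] _ _ _ _; apply: hsemilinear_of_linear. Qed.
Let act1 x : act 1 x = x. Proof. by case: XP => -[_ _ L _] _ _ _ _. Qed.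
Let actM a b x : act (a * b) x = act a (act b x).
Proof. by case: XP => -[_ _ _ L] _ _ _ _. Qed.
Let muZ : hsemilinear id mu.
Proof. by case: XP => _ L _ _ _; apply: hsemilinear_of_linear. Qed.
Let stXZ : hsemilinear Num.conj stX.
Proof. by case: XP => _ _ _ [/hconj_linear_hsemilinear]. Qed.

Let act2Z G := hact2_hsemilinear actl actr G.
Let act2l t := hact2_hadicl actl actr t.
Let act2M := hact2M actl actr actM.
Let act2pure := hact2_pure2 actl actr.

Lemma act_mul a t : act a (mu t) = mu (hact2 act (hmap (@udelta C g) a) t).
Proof.
move: t; apply: tensor_hadic_ext => [||x y].
- exact: (hadic_comp (actr a).1 muZ.1).
- exact: (hadic_comp muZ.1 (act2Z _).1).
- by case: XP => _ _ L _ _; exact: L.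
Qed.

(** The twist relation moves F^-1 across the coproduct: Delta(a) F^-1 = F^-1 Delta_h(a). *)
Lemma twisted_act_mul a t : act a (twisted_mul act mu F t) =
  twisted_mul act mu F (hact2 act (hs_delta H a) t).
Proof.
rewrite /twisted_mul -/Fi act_mul -!act2M deltaE.
by rewrite !mulrA FiF mul1r.
Qed.

Let stst := hmap (tmap st st).
Let SSflip G := hmap (tmap (@uS C g) (@uS C g)) (hmap (@tflip C U U) G).

Let stst_hadic : hadic stst.
Proof.
have [d z] := (hopf_starD stP, hopf_starZ stP).
by apply: hmap_hadic; exact: (tmapD d d z z).
Qed.
Let stst_pure x y : stst (hpure x y) = hpure (star x) (star y).
Proof.
have [d z] := (hopf_starD stP, hopf_starZ stP).
exact: (hmap_tmap_pure d d z z).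
Qed.
Let SSflip_hadic : hadic SSflip.
Proof.
have [d z] := (@uSD C g, @uSZ C g).
apply: (hadic_comp (f := hmap _)); last exact: hmap_tflip_hadic.
by apply: hmap_hadic; exact: (tmapD d d z z).
Qed.
Let SSflip_pure x y : SSflip (hpure x y) = hpure (S y) (S x).
Proof.
have [d z] := (@uSD C g, @uSZ C g).
rewrite /SSflip hmap_tflip_pure; exact: (hmap_tmap_pure d d z z).
Qed.

Let anti (f : hser (tensor U U) -> hser (tensor U U)) (fh : hadic f) :
  (forall x y x' y', f (hpure (x * x') (y * y')) = f (hpure x' y') * f (hpure x y)) ->
  {morph f : s t / s * t >-> t * s}.
Proof.
move=> fp s t; move: s; apply: tensor_hadic_ext => [||x y].
- by apply: (hadic_comp fh); exact: hmul_hadicl.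
- by apply: (hadic_comp (hmul_hadicr _)).
move: t; apply: tensor_hadic_ext => [||x' y'].
- by apply: (hadic_comp fh); exact: hmul_hadicr.
- by apply: hmul_hadicl_comp.
by rewrite hpureM fp.
Qed.

Let ststM : {morph stst : s t / s * t >-> t * s}.
Proof. by apply: anti => // *; rewrite !stst_pure hpureM !stM. Qed.
Let SSflipM : {morph SSflip : s t / s * t >-> t * s}.
Proof. by apply: anti => // *; rewrite !SSflip_pure hpureM !SM. Qed.
Let stst1 : stst 1 = 1. Proof. by rewrite -hpure1 stst_pure st1. Qed.
Let SSflip1 : SSflip 1 = 1. Proof. by rewrite -hpure1 SSflip_pure S1. Qed.
Let ststK t : stst (stst t) = t.
Proof.
move: t; apply: tensor_hadic_ext => // [|x y]; first exact: (hadic_comp stst_hadic).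
by rewrite !stst_pure !stK.
Qed.

(** The composite of the antihomomorphisms [SSflip] and [stst] is multiplicative, and it fixes F by
    reality and involutivity of the star; hence it fixes F^-1. *)
Lemma real_twist_inverse : stst (SSflip Fi) = Fi.
Proof.
rewrite -[LHS]mulr1 -FFi mulrA -[in X in _ * X * _](ststK F) [stst F]real -/(SSflip F).
by rewrite -ststM -SSflipM FiF SSflip1 stst1 mul1r.
Qed.

(** On G = a (x) b, antimultiplicativity of the star exchanges the factors, and its compatibility
    with the action replaces [a] by the star of S(a), and [b] likewise. *)
Lemma star_mul G x y : stX (mu (hact2 act G (hpure x y))) =
  mu (hact2 act (stst (SSflip G)) (hpure (stX y) (stX x))).
Proof.
move: G; apply: tensor_hadic_ext => [||a b].
- by apply: (hadic_comp stXZ.1); apply: (hadic_comp muZ.1).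
- apply: (hadic_comp muZ.1); apply: (hadic_comp (act2l _)).
  exact: (hadic_comp stst_hadic).
case: XP => _ _ _ [_ _ stmu] stact.
by rewrite SSflip_pure stst_pure !act2pure stmu !stact.
Qed.

Lemma twisted_module_star_algebra :
  module_star_algebra H act (twisted_mul act mu F) (twisted_star act stX sigma).
Proof.
have tsig := antipode_twist_selfadjoint.
have tsi : star si = si.
  have [_ h] := sts; rewrite tsig in h.
  by rewrite -[LHS]mulr1 -ssi mulrA h mul1r.
case: (XP) => XA _ _ [stXL stXK _] stact; split=> //.
- exact: hsemilinear_linear (hsemilinear_comp muZ (act2Z Fi)).
- by move=> a x y; exact: twisted_act_mul.
- rewrite /twisted_star -/si; split.
  + move=> s x y; rewrite stXL.
    exact: (hsemilinear_linear (actr si)).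
  (* Passing the star across the inner sigma^-1 yields the star of S(sigma^-1), which is sigma
     because S(sigma) = sigma^-1 and [sigma] is selfadjoint; it cancels the outer sigma^-1. *)
  + move=> x; rewrite stact -actM stXK -[hs_star _ _]/(star (S si)).
    by rewrite -antipode_twist_S SK tsig antipode_twist_S sis act1.
  (* By [real_twist_inverse] the twisted product is reversed by the original star; the group-like
     sigma^-1 then acts on each factor separately. *)
  + move=> x y; rewrite /twisted_mul -/Fi star_mul real_twist_inverse.
    rewrite -/(twisted_mul act mu F _) twisted_act_mul.
    by rewrite (grouplike_inverse antipode_twist_inverses sPd) act2pure.
(* With sigma selfadjoint, the star of S_h(a) is sigma^-1 (star S(a)) sigma, whose last factor
   cancels the sigma^-1 of the twisted star. *)
- move=> a x; rewrite /twisted_star -/si stact -!actM /=.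
  rewrite -[alpha _]/(hs_S H a) sPS !stM tsig tsi.
  by rewrite -!mulrA ssi mulr1.
Qed.

Let epslFi : epsl Fi = 1.
Proof. by case: FP => _ _ F1 _; rewrite -[LHS]mul1r -{1}F1 -epslM FFi epsl1. Qed.
Let epsrFi : epsr Fi = 1.
Proof. by case: FP => _ _ _ F1; rewrite -[LHS]mul1r -{1}F1 -epsrM FFi epsr1. Qed.

(* Uniqueness of the counit: eps is also a counit for the twisted coproduct. *)
Lemma transferred_eps x : hs_eps H x = hmap (@ueps C g) x.
Proof.
case: alphaP => -[aK a'K] _ _ _ _.
have ehZ : hsemilinear id (hs_eps H : hser U -> hser C^o).
  exact: (transferred_eps_hsemilinear st aK a'K).
have br := functional_bihadicr U ehZ.
have eZ := hmap_ueps_hsemilinear g.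
have epsl_delta : epsl (hs_delta H x) = x.
  by rewrite deltaE !epslM epslFi epsl_udelta; case: FP => _ _ F1 _;
    rewrite [epsl F]F1 mul1r mulr1.
rewrite -{1}epsl_delta -{2}(transferred_counitr st aK a'K x) -/H.
move: (hs_delta H x); apply: tensor_hadic_ext => [||v w].
- exact: (hadic_comp ehZ.1 (@epsl_hadic C g)).
- exact: (hadic_comp eZ.1 (hlift_hadic br)).
by rewrite epsl_pure (hlift_pure br) hmap_uepsZ mulrC (hsemilinearZ ehZ).
Qed.

(** Because a acts on [e] through the counit, F^-1 acting on a tensor with one leg [e] is contracted
    to 1 on the other leg, F^-1 being counital like F. *)
Lemma twisted_unit e : module_algebra_unit (classical_hopf st) act mu e ->
  module_algebra_unit H act (twisted_mul act mu F) e.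
Proof.
move=> [mue acte]; split; last by move=> a; rewrite transferred_eps acte.
move=> x; rewrite /twisted_mul -/Fi; split.
  rewrite -[RHS]act1 -epslFi; move: Fi; apply: tensor_hadic_ext => [||a b].
  - exact: (hadic_comp muZ.1 (act2l _)).
  - exact: (hadic_comp (actl x).1 (@epsl_hadic C g)).
  by rewrite act2pure acte hpure_scalel (hsemilinearZ muZ)
    epsl_pure (hsemilinearZ (actl x)) (mue _).1.
rewrite -[RHS]act1 -epsrFi; move: Fi; apply: tensor_hadic_ext => [||a b].
- exact: (hadic_comp muZ.1 (act2l _)).
- exact: (hadic_comp (actl x).1 (@epsr_hadic C g)).
by rewrite act2pure acte hpure_scaler (hsemilinearZ muZ)
    epsr_pure (hsemilinearZ (actl x)) (mue _).2.
Qed.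

End Module.

End Twist.

Theorem proposition4 (R : realType) (g : lieAlgebra R[i])
    (st : enveloping g -> enveloping g)
    (D : hadicHopf R[i]) (stD : hser D -> hser D) (p : {linear D -> enveloping g})
    (alpha : {linear hser D -> hser (enveloping g)}) (alpha' : hser (enveloping g) -> hser D)
    (F : hser (tensor (enveloping g) (enveloping g))) (sigma : hser (enveloping g))
    (W : lmodType R[i]) (act : hser (enveloping g) -> hser W -> hser W)
    (mu : hser (tensor W W) -> hser W) (stX : hser W -> hser W) :
  semisimple g ->
  hopf_star st ->
  drinfeld_jimbo_of g D ->
  hadic_hopf_star stD ->
  hopf_star_reduction stD st p ->
  star_algebra_iso stD st p alpha alpha' ->
  drinfeld_twist (transferred_hopf st alpha alpha') F ->
  real_twist st F ->
  antipode_twist (transferred_hopf st alpha alpha') sigma ->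
  module_star_algebra (classical_hopf st) act mu stX ->
  module_star_algebra (transferred_hopf st alpha alpha') act
    (twisted_mul act mu F) (twisted_star act stX sigma) /\
  (forall e, module_algebra_unit (classical_hopf st) act mu e ->
     module_algebra_unit (transferred_hopf st alpha alpha') act
       (twisted_mul act mu F) e).
Proof.
move=> ss stP _ stDP _ aP FP Fr sP XP; split.
  exact: (twisted_module_star_algebra ss stP stDP aP FP sP Fr XP).
exact: (twisted_unit aP FP XP).
Qed.
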